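(* There is a constant $c$ depending only on $d$ and $\kappa$ such that for every $f\in L^1(h_\kappa^2;S^d)$ and every $x\in S^d$, $$\mathcal M_\kappa f(x)\le c\sum_{\varepsilon\in\mathbb Z_2^{d+1}}M_\kappa f(x\varepsilon).$$
   Context: $S^d$ is the unit sphere in $\mathbb R^{d+1}$ with surface measure $d\omega$; $\kappa=(\kappa_1,\dots,\kappa_{d+1})$, $\kappa_i\ge0$; $h_\kappa(x)=\prod_{i=1}^{d+1}|x_i|^{\kappa_i}$. $V_\kappa f(x)=c_\kappa\int_{[-1,1]^{d+1}}f(x_1t_1,\dots,x_{d+1}t_{d+1})\prod_{i}(1+t_i)(1-t_i^2)^{\kappa_i-1}dt$, normalized by $V_\kappa1=1$ (factors with $\kappa_i=0$ via the limit $\frac12[g(1)+g(-1)]$). $B(x,\theta)=\{y\in\mathbb R^{d+1}:\|y\|\le1,\langle x,y\rangle\ge\cos\theta\}$, $c(x,\theta)=\{y\in S^d:\langle x,y\rangle\ge\cos\theta\}$. $$\mathcal M_\kappa f(x)=\sup_{0<\theta\le\pi}\frac{\int_{S^d}|f(y)|V_\kappa[\chi_{B(x,\theta)}](y)h_\kappa^2(y)d\omega(y)}{\int_{S^d}V_\kappa[\chi_{B(x,\theta)}](y)h_\kappa^2(y)d\omega(y)},\qquad M_\kappa f(x)=\sup_{0<\theta\le\pi}\frac{\int_{c(x,\theta)}|f|h_\kappa^2d\omega}{\int_{c(x,\theta)}h_\kappa^2d\omega}.$$ For $\varepsilon\in\mathbb Z_2^{d+1}=\{-1,1\}^{d+1}$,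 $x\varepsilon=(x_1\varepsilon_1,\dots,x_{d+1}\varepsilon_{d+1})$. *)

(* Defs.v *)
From HB Require Import structures.
From mathcomp Require Import all_boot all_order all_algebra.
From mathcomp Require Import all_classical all_reals all_analysis.

Set Implicit Arguments.
Unset Strict Implicit.
Unset Printing Implicit Defensive.

Import Order.TTheory GRing.Theory Num.Theory.
Local Open Scope ring_scope.
Local Open Scope classical_set_scope.

Section WeightedSphere.
Variable R : realType.

(* Points of R^n are n-tuples of reals (product Borel sigma-algebra). *)

(* Iterated integration over n coordinates: coordinate i is integrated
   against the one-dimensional functional [J i] (innermost = last coordinate).
   Used only for nonnegative integrands, for which (Tonelli) this is the
   integral with respect to the product of the one-dimensional measures. *)
Fixpoint iterint (J : nat -> (R -> \bar R) -> \bar R) (n : nat)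
  : (n.-tuple R -> \bar R) -> \bar R :=
  match n with
  | 0%N => fun g => g [tuple]
  | n'.+1 => fun g =>
      J 0%N (fun t => @iterint (fun i => J i.+1) n' (fun y => g (cons_tuple t y)))
  end.

Definition leb_int (n : nat) (g : n.-tuple R -> \bar R) : \bar R :=
  iterint (fun _ phi => (\int[lebesgue_measure]_t phi t)%E) g.

Definition dotp (n : nat) (x y : n.-tuple R) : R :=
  \sum_(i < n) tnth x i * tnth y i.

Definition vnorm (n : nat) (x : n.-tuple R) : R := Num.sqrt (dotp x x).

Definition vscale (n : nat) (a : R) (x : n.-tuple R) : n.-tuple R :=
  [tuple a * tnth x i | i < n].

Definition sphere (d : nat) : set (d.+1.-tuple R) := [set x | dotp x x = 1].

(* integral over S^d w.r.t. the surface measure d omega, via the cone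
   (polar-coordinates) formula
     \int_{S^d} F d omega = (d+1) \int_{0 < |y| <= 1} F(y/|y|) dy. *)
Definition sphere_int (d : nat) (F : d.+1.-tuple R -> \bar R) : \bar R :=
  ((d.+1)%:R%:E * leb_int (fun y =>
     if ((0 < vnorm y) && (vnorm y <= 1))%R then F (vscale (vnorm y)^-1%R y)
     else 0%E))%E.

Definition hk (d : nat) (k : d.+1.-tuple R) (x : d.+1.-tuple R) : R :=
  \prod_(i < d.+1) (`|tnth x i| `^ tnth k i).

Definition I11 : set R := `[-1, 1].

Definition ck (k : R) : R :=
  (fine (\int[lebesgue_measure]_(t in I11)
           ((1 + t) * (1 - t ^+ 2) `^ (k - 1))%R%:E)%E)^-1.

(* one-dimensional factor of V_kappa; for k = 0 it is the limit
   (1/2)[(1+t)phi(t)]_{t=1} + (1/2)[(1+t)phi(t)]_{t=-1} *)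
Definition Jk (k : R) (phi : R -> \bar R) : \bar R :=
  if k == 0 then
    ((1/2)%R%:E * ((1 + 1)%R%:E * phi 1%R + (1 - 1)%R%:E * phi (-1)%R))%E
  else
    ((ck k)%:E * \int[lebesgue_measure]_(t in I11)
        (phi t * ((1 + t) * (1 - t ^+ 2) `^ (k - 1))%R%:E)%E)%E.

Definition Vk (d : nat) (k : d.+1.-tuple R) (g : d.+1.-tuple R -> \bar R)
  (x : d.+1.-tuple R) : \bar R :=
  iterint (fun i => Jk (nth 0 k i))
    (fun t : d.+1.-tuple R => g [tuple tnth x i * tnth t i | i < d.+1]).

Definition chiB (d : nat) (x : d.+1.-tuple R) (theta : R) (y : d.+1.-tuple R)
  : \bar R :=
  if (vnorm y <= 1) && (cos theta <= dotp x y) then 1%E else 0%E.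

Definition Mcal_ratio (d : nat) (k : d.+1.-tuple R) (f : d.+1.-tuple R -> R)
  (x : d.+1.-tuple R) (theta : R) : \bar R :=
  (sphere_int (fun y => ((`|f y| * hk k y ^+ 2)%R%:E * Vk k (chiB x theta) y)%E)
   * ((fine (sphere_int (fun y => (Vk k (chiB x theta) y * (hk k y ^+ 2)%R%:E)%E)))^-1)%R%:E)%E.

Definition Mcal (d : nat) (k : d.+1.-tuple R) (f : d.+1.-tuple R -> R)
  (x : d.+1.-tuple R) : \bar R :=
  ereal_sup [set Mcal_ratio k f x theta | theta in `]0, pi]].

(* the cap c(x,theta) = {y in S^d | <x,y> >= cos theta}; restriction to S^d
   is performed by the sphere integral *)
Definition M_ratio (d : nat) (k : d.+1.-tuple R) (f : d.+1.-tuple R -> R)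
  (x : d.+1.-tuple R) (theta : R) : \bar R :=
  (sphere_int (fun y => if (cos theta <= dotp x y)%R
                        then (`|f y| * hk k y ^+ 2)%R%:E else 0%E)
   * ((fine (sphere_int (fun y => if (cos theta <= dotp x y)%R
                        then (hk k y ^+ 2)%R%:E else 0%E)))^-1)%R%:E)%E.

Definition Msmall (d : nat) (k : d.+1.-tuple R) (f : d.+1.-tuple R -> R)
  (x : d.+1.-tuple R) : \bar R :=
  ereal_sup [set M_ratio k f x theta | theta in `]0, pi]].

Definition reflect_by (d : nat) (e : d.+1.-tuple bool) (x : d.+1.-tuple R)
  : d.+1.-tuple R :=
  [tuple (if tnth e i then - tnth x i else tnth x i) | i < d.+1].

Definition L1_hk (d : nat) (k : d.+1.-tuple R) (f : d.+1.-tuple R -> R) : Prop :=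
  measurable_fun (@sphere d) f /\
  (sphere_int (fun y => (`|f y| * hk k y ^+ 2)%R%:E) < +oo)%E.

End WeightedSphere.

Arguments sphere : clear implicits.

(* Main.v *)
Require Import Defs.
From HB Require Import structures.
From mathcomp Require Import all_boot all_order all_algebra.
From mathcomp Require Import all_classical all_reals all_analysis.
From mathcomp Require Import measurable_realfun ring lra.
Import Order.TTheory GRing.Theory Num.Theory.
Import numFieldNormedType.Exports HBNNSimple.
Local Open Scope ring_scope.

(** Both maximal quotients are compared at the same angle [t].  Write
    [q_i = t^2 / (|x_i| + t)^2].  If [u] is on the sphere and
    [V_k chi_B(x,t) (u)] does not vanish, then [sum |x_i u_i| >= cos t], so [u]
    lies in the cap of radius [t] around some reflection of [x], and the
    [tau] with [x.(u tau) >= cos t] satisfy [1 -/+ tau_i <= 18 q_i]; each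
    one-dimensional factor gives at most a multiple of [q_i^k_i].  Hence
    [V_k chi_B(x,t) <= C P], with [P] the product of the normalized [q_i^k_i].
    Conversely [V_k chi_B(x,t) >= c P] on a cap of radius comparable to [t].
    It remains to see that the [h_k^2]-mass of a cap is comparable to
    [t^d prod (|x_i| + t)^(2 k_i)].  As the surface integral is an integral over
    cones, the upper bound follows by covering the cone over the cap with about
    [1/t] boxes of side [4 t], and the lower bound by packing about [1/t] disjoint
    boxes in it, pushed away from the coordinate hyperplanes. *)

Set Implicit Arguments.
Unset Strict Implicit.
Unset Printing Implicit Defensive.

(** * Iterated integrals of nonnegative functions, and their values on boxes *)

Section IteratedIntegrals.
Variable R : realType.
Local Open Scope classical_set_scope.
Implicit Types (J : nat -> (R -> \bar R) -> \bar R) (A : nat -> R -> bool).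

(* No measurability is assumed, so that of [V_k chi_B] is never needed. *)
Lemma ge0_integral_mono d (T : measurableType d)
    (mu : {measure set T -> \bar R}) (D E : set T) (f g : T -> \bar R) :
  D `<=` E -> (forall x, E x -> (0 <= g x)%E) ->
  (forall x, D x -> (0 <= f x <= g x)%E) ->
  (\int[mu]_(x in D) f x <= \int[mu]_(x in E) g x)%E.
Proof.
move=> DE g0 fg.
rewrite !ge0_integralE//; last by move=> x /fg /andP[].
apply: ge_ereal_sup => _ /= [h hf <-]; apply: ereal_sup_ubound => /=.
exists h => //= x; apply: (le_trans (hf x)).
rewrite /patch; case: ifPn => [/set_mem Dx|_].
  by rewrite mem_set; [case/andP: (fg _ Dx)|exact: DE].
by case: ifPn => // /set_mem /g0.
Qed.

(** Nonnegativity and monotonicity are bundled because each inner integral must be nonnegative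
    before the next one can be compared. [S] will be [[-1, 1]] for the factors of [V_k] and [setT]
    for Lebesgue measure. *)
Definition monotone_on (S : set R) (F : (R -> \bar R) -> \bar R) :=
  forall phi psi, (forall t, S t -> (0 <= phi t <= psi t)%E) ->
  (0 <= F phi <= F psi)%E.

Lemma iterint_mono (S : set R) n J (g h : n.-tuple R -> \bar R) :
  (forall i, monotone_on S (J i)) ->
  (forall t : n.-tuple R, (forall i, S (tnth t i)) -> (0 <= g t <= h t)%E) ->
  (0 <= iterint J g <= iterint J h)%E.
Proof.
elim: n J g h => [|n IH] J g h mJ gh /=; first by apply: gh => -[].
apply: (mJ 0%N) => t St; apply: IH => [i|y Sy]; first exact: mJ.
apply: gh => i; case: (unliftP ord0 i) => [j ->|->]; last by [].
by rewrite tnthS.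
Qed.

Lemma iterint_ge0 (S : set R) n J (g : n.-tuple R -> \bar R) :
  (forall i, monotone_on S (J i)) ->
  (forall t : n.-tuple R, (forall i, S (tnth t i)) -> (0 <= g t)%E) ->
  (0 <= iterint J g)%E.
Proof.
move=> mJ g0; suff : (0 <= iterint J g <= iterint J g)%E by case/andP.
by apply: (iterint_mono mJ) => t /g0 ->; rewrite lexx.
Qed.

Fixpoint in_box A (y : seq R) : bool :=
  if y is t :: y' then A 0%N t && in_box (fun i => A i.+1) y' else true.

Lemma in_boxP A n (y : n.-tuple R) :
  reflect (forall i : 'I_n, A i (tnth y i)) (in_box A y).
Proof.
elim: n A y => [|n IH] A y.
  by rewrite tuple0 /=; constructor => -[].
case/tupleP: y => t y /=; apply: (iffP andP) => [[A0 Ay] i|Ay].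
  case: (unliftP ord0 i) => [j ->|->]; last by [].
  by rewrite tnthS; exact: (IH _ _ Ay).
split; first exact: (Ay ord0).
by apply/IH => i; have := Ay (lift ord0 i); rewrite tnthS.
Qed.

(** The value [a] is a parameter so that a slice of such a function has the same form, with value
    [a] or [0]. *)
Definition box_cst A (a : R) n (y : n.-tuple R) : \bar R :=
  if in_box A y then a%:E else 0%E.

Lemma box_cst_cons A a n t (y : n.-tuple R) :
  box_cst A a (cons_tuple t y) =
  box_cst (fun i => A i.+1) (if A 0%N t then a else 0) y.
Proof. by rewrite /box_cst /=; case: (A 0%N t) => //=; case: ifP. Qed.

(** Induction on the dimension: by [box_cst_cons] the inner integral is at most [a * P] or [0]
    according to [A 0 t], and this bound is the integrand of the one-dimensional hypothesis at
    [r = a * P]. *)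
Lemma iterint_box_le (S : set R) n J A (b : nat -> R) (a : R) :
  (forall i, monotone_on S (J i)) -> (forall i, 0 <= b i) ->
  (forall i (r : R), 0 <= r ->
     (J i (fun t => (if A i t then r else 0)%:E) <= (r * b i)%:E)%E) ->
  0 <= a ->
  (iterint J (@box_cst A a n) <= (a * \prod_(i < n) b i)%:E)%E.
Proof.
elim: n J A b a => [|n IH] J A b a mJ b0 bJ a0 /=.
  by rewrite big_ord0 mulr1.
rewrite big_ord_recl mulrCA mulrC.
pose P := \prod_(i < n) b i.+1.
have P0 : 0 <= P by apply: prodr_ge0.
apply: le_trans (bJ 0%N (a * P) _); last exact: mulr_ge0.
set psi := (X in (_ <= J _ X)%E).
suff /(mJ 0%N) :  forall t, S t -> (0 <= iterint (fun i => J i.+1)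
   (fun y : n.-tuple R => box_cst A a (cons_tuple t y)) <= psi t)%E.
  by case/andP.
move=> t St; rewrite (_ : (fun y : n.-tuple R => _) =
    @box_cst (fun i => A i.+1) (if A 0%N t then a else 0) n); last first.
  by apply/funext => y; rewrite box_cst_cons.
apply/andP; split.
  apply: (@iterint_ge0 S) => [i|y _]; first exact: mJ.
  by rewrite /box_cst; case: ifP => // _; rewrite lee_fin; case: ifP.
apply: le_trans (IH _ _ (fun i => b i.+1) _ _ _ _ _) _ => //.
- by move=> i r r0; exact: bJ.
- by case: ifP.
- by rewrite /psi; case: ifP => // _; rewrite mul0r.
Qed.

Lemma iterint_box_ge (S : set R) n J A (b : nat -> R) (a : R) :
  (forall i, monotone_on S (J i)) -> (forall i, 0 <= b i) ->
  (forall i (r : R), 0 <= r ->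
     ((r * b i)%:E <= J i (fun t => (if A i t then r else 0)%:E))%E) ->
  0 <= a ->
  ((a * \prod_(i < n) b i)%:E <= iterint J (@box_cst A a n))%E.
Proof.
elim: n J A b a => [|n IH] J A b a mJ b0 bJ a0 /=.
  by rewrite big_ord0 mulr1.
rewrite big_ord_recl mulrCA mulrC.
pose P := \prod_(i < n) b i.+1.
have P0 : 0 <= P by apply: prodr_ge0.
apply: (le_trans (bJ 0%N (a * P) _)); first exact: mulr_ge0.
set psi := (X in (_ <= J _ X)%E).
set phi := (X in (J _ X <= _)%E).
suff /(mJ 0%N) :  forall t, S t -> (0 <= phi t <= psi t)%E.
  by case/andP.
move=> t St; rewrite /psi (_ : (fun y : n.-tuple R => _) =
    @box_cst (fun i => A i.+1) (if A 0%N t then a else 0) n); last first.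
  by apply/funext => y; rewrite box_cst_cons.
apply/andP; split; first by rewrite lee_fin /phi; case: ifP => // _; exact: mulr_ge0.
apply: le_trans (IH _ _ (fun i => b i.+1) _ _ _ _ _) => //.
- by rewrite /phi; case: ifP => // _; rewrite mul0r.
- by move=> i r r0; exact: bJ.
- by case: ifP.
Qed.

Lemma lebesgue_monotone_on :
  monotone_on setT (fun phi => (\int[lebesgue_measure]_t phi t)%E).
Proof.
move=> phi psi pp; apply/andP; split.
  by apply: integral_ge0 => t /pp /andP[].
by apply: ge0_integral_mono => // t tT; case/andP: (pp t tT) => /le_trans; apply.
Qed.

Lemma integral_indicator (r c h : R) : 0 <= h ->
  (\int[lebesgue_measure]_t (if `|t - c| <= h then r else 0)%:E =
   (r * (2 * h))%:E)%E.
Proof.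
move=> h0.
rewrite (_ : (fun t => _) = (cst r%:E) \_ `[c - h, c + h]); last first.
  apply/funext => t; rewrite patchE mem_setE in_itv /= ler_distl.
  by case: ifP.
rewrite -integral_mkcond integral_cst//= lebesgue_measure_itv/= lte_fin.
(* The length formula tests whether the endpoints are strictly ordered, which fails only for
   [h = 0]. *)
case: ifPn => hc; first by rewrite -EFinD -EFinM; congr EFin; ring.
have -> : h = 0 by apply/eqP; rewrite eq_le h0 andbT; move: hc; lra.
by rewrite !mulr0 mule0.
Qed.

Lemma leb_int_box n (c h : nat -> R) (a : R) : (forall i, 0 <= h i) -> 0 <= a ->
  leb_int (@box_cst (fun i t => `|t - c i| <= h i) a n) =
  (a * \prod_(i < n) (2 * h i))%:E.
Proof.
move=> h0 a0; apply/eqP; rewrite eq_le; apply/andP; split.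
  apply: (@iterint_box_le setT n _ (fun i t => `|t - c i| <= h i) (fun i => 2 * h i)) => // [_|i|i r r0].
  - exact: lebesgue_monotone_on.
  - exact: mulr_ge0.
  - by rewrite integral_indicator.
apply: (@iterint_box_ge setT n _ (fun i t => `|t - c i| <= h i) (fun i => 2 * h i)) => // [_|i|i r r0].
- exact: lebesgue_monotone_on.
- exact: mulr_ge0.
- by rewrite integral_indicator.
Qed.

Lemma leb_int_mono n (g h : n.-tuple R -> \bar R) :
  (forall y, (0 <= g y <= h y)%E) -> (0 <= leb_int g <= leb_int h)%E.
Proof.
by move=> gh; apply: (@iterint_mono setT) => // _; exact: lebesgue_monotone_on.
Qed.

Lemma leb_int_ge0 n (g : n.-tuple R -> \bar R) :
  (forall y, (0 <= g y)%E) -> (0 <= leb_int g)%E.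
Proof.
by move=> g0; apply: (@iterint_ge0 setT) => // _; exact: lebesgue_monotone_on.
Qed.

(** Tonelli by induction: the first coordinate moves from the tuple into the parameter space, which
    is why [T] is arbitrary. *)
Lemma measurable_leb_int_param d (T : measurableType d) n
    (g : T * n.-tuple R -> \bar R) :
  measurable_fun setT g -> (forall z, (0 <= g z)%E) ->
  measurable_fun setT (fun x => leb_int (fun y => g (x, y))).
Proof.
elim: n d T g => [|n IH] d T g mg g0 /=.
  by apply: (measurableT_comp mg); apply: measurable_fun_pair; [exact: measurable_id|exact: measurable_cst].
pose g' (z : (T * R) * n.-tuple R) := g (z.1.1, cons_tuple z.1.2 z.2).
have mg' : measurable_fun setT g'.
  apply: (measurableT_comp mg); apply/measurable_fun_pairP; split => /=.
    exact: (measurableT_comp measurable_fst measurable_fst).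
  apply: measurable_cons => //.
  exact: (measurableT_comp measurable_snd measurable_fst).
have mG := IH _ _ g' mg' (fun z => g0 _).
apply: (@measurable_fun_fubini_tonelli_F _ _ T (measurableTypeR R) R
  lebesgue_measure _ mG) => z.
by apply: leb_int_ge0 => y; exact: g0.
Qed.

Lemma measurable_leb_int_cons n (g : n.+1.-tuple R -> \bar R) :
  measurable_fun setT g -> (forall z, (0 <= g z)%E) ->
  measurable_fun setT (fun t => leb_int (fun y => g (cons_tuple t y))).
Proof.
move=> mg g0.
apply: (@measurable_leb_int_param _ _ n (fun z => g (cons_tuple z.1 z.2))) => //.
by apply: (measurableT_comp mg); exact: measurable_cons.
Qed.

Lemma measurable_cons_comp n (g : n.+1.-tuple R -> \bar R) t :
  measurable_fun setT g ->
  measurable_fun setT (fun y : n.-tuple R => g (cons_tuple t y)).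
Proof. by move=> mg; apply: (measurableT_comp mg); exact: measurable_cons. Qed.

Lemma leb_int_sum (I : Type) (s : seq I) n (g : I -> n.-tuple R -> \bar R) :
  (forall i, measurable_fun setT (g i)) -> (forall i y, (0 <= g i y)%E) ->
  leb_int (fun y => (\sum_(i <- s) g i y)%E) = (\sum_(i <- s) leb_int (g i))%E.
Proof.
elim: n g => [//|n IH] g mg g0.
transitivity (\int[lebesgue_measure]_t
    (\sum_(i <- s) leb_int (fun y => g i (cons_tuple t y))))%E.
  apply: eq_integral => t _; apply: IH => // i.
  by apply: measurable_cons_comp; exact: mg.
rewrite ge0_integral_sum// => [i|i t _].
  by apply: measurable_leb_int_cons; [exact: mg|exact: g0].
by apply: leb_int_ge0 => y; exact: g0.
Qed.

Lemma leb_intZ n (r : R) (g : n.-tuple R -> \bar R) : 0 <= r ->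
  measurable_fun setT g -> (forall y, (0 <= g y)%E) ->
  leb_int (fun y => (r%:E * g y)%E) = (r%:E * leb_int g)%E.
Proof.
move=> r0; elim: n g => [//|n IH] g mg g0.
transitivity (\int[lebesgue_measure]_t
    (r%:E * leb_int (fun y => g (cons_tuple t y))))%E.
  by apply: eq_integral => t _; apply: IH => //; exact: measurable_cons_comp.
rewrite ge0_integralZl_EFin//.
- by move=> t _; apply: leb_int_ge0 => y; exact: g0.
- exact: measurable_leb_int_cons.
Qed.

Lemma measurable_box_cst (c h : nat -> R) (a : R) n :
  measurable_fun setT (@box_cst (fun i t => `|t - c i| <= h i) a n).
Proof.
elim: n c h a => [|n IH] c h a.
  rewrite (_ : box_cst _ _ (n:=0) = cst a%:E); first exact: measurable_cst.
  by apply/funext => y; rewrite /box_cst tuple0.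
pose A0 := fun y : n.+1.-tuple R => `|thead y - c 0%N| <= h 0%N.
rewrite (_ : box_cst _ _ (n:=n.+1) = fun y : n.+1.-tuple R =>
   if A0 y then @box_cst (fun i t => `|t - c i.+1| <= h i.+1) a n
     [tuple of behead y] else 0%E); last first.
  apply/funext => y; rewrite [in LHS](tuple_eta y) (box_cst_cons _ a (thead y) [tuple of behead y]) /A0.
  by case: ifP => //; rewrite /box_cst; case: ifP.
apply: measurable_fun_ifT => //; last first.
  by apply: (measurableT_comp (IH (fun i => c i.+1) (fun i => h i.+1) a));
    exact: measurable_behead.
apply: measurable_fun_ler => //.
apply: measurableT_comp => //; apply: measurable_funB => //.
exact: measurable_tnth.
Qed.

End IteratedIntegrals.

(** * One-dimensional calculus: a power singularity and bounds on [1 - cos t] *)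

Section OneDim.
Variable R : realType.
Local Open Scope classical_set_scope.

Lemma is_derive1_powR1B (p x : R) : x < 1 ->
  is_derive x 1 (fun t : R => (1 - t) `^ p) (- (p * (1 - x) `^ (p - 1))).
Proof.
move=> x1; have h : 0 < 1 - x by rewrite subr_gt0.
have d1 : is_derive x (1 : R) (fun t : R => 1 - t) (- 1).
  by apply: is_derive_eq; rewrite add0r mul1r.
have d2 := is_derive1_powR p h.
have := @is_derive1_comp _ (fun y : R => y `^ p) (fun t : R => 1 - t) x _ _ d2 d1.
by rewrite mulrN1.
Qed.

(** For [p < 1] the integrand is unbounded at 1, so the fundamental theorem of calculus is applied
    on [[a, b n]] with [b n] increasing to 1, and monotone convergence gives the limit. *)
Lemma integral_powR1B_le (p a : R) : 0 < p -> a < 1 ->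
  (\int[lebesgue_measure]_(t in `[a, 1%R[) ((1 - t) `^ (p - 1))%:E <=
   ((1 - a) `^ p / p)%:E)%E.
Proof.
move=> p0 a1.
(* The shift by 2 makes [a < b n] hold already at [n = 0]. *)
pose b n : R := 1 - (1 - a) / n.+2%:R.
have an n : a < b n.
  rewrite /b ltrBrDr -ltrBrDl ltr_pdivrMr// ltr_pMr ?subr_gt0//.
  by rewrite ltr1n.
have bn1 n : b n < 1.
  by rewrite /b ltrBlDr ltrDl divr_gt0// subr_gt0.
have der (x : R) : x < 1 -> is_derive x 1 (fun t : R => - p^-1 * (1 - t) `^ p)
    ((1 - x) `^ (p - 1)).
  move=> x1; have d := is_derive1_powR1B p x1.
  have := @is_deriveZ _ _ _ _ (- p^-1) _ _ _ d.
  by rewrite /GRing.scale/= mulrNN mulrA mulVf ?mul1r// gt_eqF.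
have cb n : (\int[lebesgue_measure]_(t in `[a, b n]) ((1 - t) `^ (p - 1))%:E
    <= ((1 - a) `^ p / p)%:E)%E.
  have F2 := @continuous_FTC2 R (fun t => (1 - t) `^ (p - 1))
    (fun t => - p^-1 * (1 - t) `^ p) a (b n) (an n).
  rewrite F2.
  - rewrite -EFinD lee_fin !mulNr opprK addrC mulrC lerBlDr lerDl.
    by rewrite mulr_ge0 ?powR_ge0// invr_ge0 ltW.
  - apply: derivable_within_continuous => x; rewrite in_itv/= => /andP[_ xb].
    have x1 := le_lt_trans xb (bn1 n).
    by case: (is_derive1_powR1B (p - 1) x1).
  - have cF (x : R) : x < 1 -> {for x, continuous (fun t : R => - p^-1 * (1 - t) `^ p)}.
      move=> x1; apply/differentiable_continuous/derivable1_diffP.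
      by case: (der x x1).
    split.
    + move=> x; rewrite in_itv/= => /andP[_ xb].
      by case: (der x (lt_trans xb (bn1 n))).
    + by apply: cvg_at_right_filter; apply: cF.
    + by apply: cvg_at_left_filter; apply: cF.
  - move=> x; rewrite in_itv/= => /andP[_ xb].
    by rewrite derive1E; case: (der x (lt_trans xb (bn1 n))).
have bn_mono : nondecreasing_seq (fun n => `[a, b n]%classic).
  move=> m n mn; apply/subsetPset => x /=; rewrite !in_itv/= => /andP[-> /=].
  move=> /le_trans; apply; rewrite /b lerD2l lerN2 ler_pM2l ?subr_gt0//.
  by rewrite lef_pV2 ?posrE// ler_nat.
have mf (D : set R) : measurable_fun D (fun t : R => ((1 - t) `^ (p - 1))%:E).
  apply/measurable_EFinP; apply: measurable_funTS.
  apply: (measurableT_comp (measurable_powR (p - 1))).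
  by apply: measurable_funB.
have := @ge0_nondecreasing_set_cvg_integral _ (measurableTypeR R) R (fun n => `[a, b n]%classic)
  (fun t => ((1 - t) `^ (p - 1))%:E) lebesgue_measure bn_mono
  (fun n => measurable_itv _) (fun n => mf _)
  (fun n x _ => lee_tofin (powR_ge0 _ _)).
rewrite (_ : \bigcup_i _ = `[a, 1[%classic); last first.
  apply/seteqP; split => x /=.
    move=> [n _] /=; rewrite !in_itv/= => /andP[-> /le_lt_trans]; exact.
  rewrite in_itv/= => /andP[ax x1].
  have x0 : 0 < 1 - x by rewrite subr_gt0.
  (* [x <= b n] amounts to [(1 - a) / (1 - x) <= n + 2]. *)
  exists (Num.truncn ((1 - a) / (1 - x))) => //=.
  rewrite in_itv/= ax/= /b lerBrDr -lerBrDl ler_pdivrMr// mulrC -ler_pdivrMr//.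
  apply: (le_trans (ltW (truncnS_gt _))).
  by rewrite ler_nat.
move=> cv; have <- := cvg_lim (@ereal_hausdorff R) cv.
apply: lime_le; first by apply/cvg_ex; eexists; exact: cv.
by apply: nearW => n; exact: cb.
Qed.

(** Up to 1 the mean value theorem gives slope at least [cos 1]; beyond 1, [sin s >= sin 1 >= cos 1]
    while [s <= 2]. *)
Lemma sin_ge_linear (s : R) : 0 <= s <= pi / 2 -> cos 1 / 2 * s <= sin s.
Proof.
have sin_cos1 (t : R) : 0 <= t <= 1 -> cos 1 * t <= sin t.
  move=> /andP[t0 t1].
  have [c /itvP cin] := @MVT_segment R sin cos 0 t t0
    (fun x _ => is_derive_sin x) (continuous_subspaceT (@continuous_sin R)).
  rewrite sin0 !subr0 => ->; apply: ler_wpM2r => //.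
  have c1 : c <= 1 by rewrite (le_trans _ t1) ?cin.
  have : c <= 1 by [].
  rewrite le_eqVlt => /predU1P[->//|cl1].
  have c0 : 0 <= c by rewrite cin.
  have p2 := pi_ge2 R.
  by apply: ltW; rewrite ltr_cos ?in_itv/=; try (apply/andP; split); lra.
move=> /andP[s0 spi]; have [s1|s1] := leP s 1.
  apply: (le_trans _ (sin_cos1 s _)); last by rewrite s0.
  by have := cos1_gt0 R; nra.
have h1 := sin_cos1 1; rewrite mulr1 in h1.
have s2 : s <= 2 by apply: (le_trans spi); rewrite ltW// pihalf_lt2.
have hs : sin 1 <= sin s.
  have p1 := pihalf_ge1 R; have p2 := pi_gt0 R.
  by apply: ltW; rewrite ltr_sin// ?in_itv/=; lra.
have := h1; have := cos1_gt0 R; nra.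
Qed.

Lemma one_subr_cos (t : R) : 1 - cos t = 2 * sin (t / 2) ^+ 2.
Proof.
have -> : cos t = cos ((t / 2) *+ 2) by rewrite -mulr_natr divfK.
by rewrite cos_mulr2n cos2sin2; ring.
Qed.

(** [(cos 1 / 4) ^+ 2] becomes the [b] of the lower estimates. The factor 2 is shared there: one
    half for the distance from [u] to [x], one half for the integration variables of [V_k]. *)
Lemma one_subr_cos_ge (t : R) : 0 < t <= pi ->
  2 * (cos 1 / 4) ^+ 2 * t ^+ 2 <= 1 - cos t.
Proof.
move=> /andP[t0 tpi]; rewrite one_subr_cos.
have := @sin_ge_linear (t / 2); have c0 := cos1_gt0 R.
have -> : 0 <= t / 2 <= pi / 2 by apply/andP; split; lra.
move=> /(_ isT) h; rewrite -mulrA ler_pM2l// -exprMn.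
apply: lerXn2r; rewrite ?nnegrE; [by nra|by apply: le_trans h; nra|].
by apply: le_trans h; nra.
Qed.

Lemma sin_le_id (t : R) : 0 <= t -> sin t <= t.
Proof.
move=> t0.
have [c _] := @MVT_segment R sin cos 0 t t0
  (fun x _ => is_derive_sin x) (continuous_subspaceT (@continuous_sin R)).
by rewrite sin0 !subr0 => ->; rewrite ler_piMl ?cos_le1.
Qed.

Lemma one_subr_cos_le (t : R) : 0 < t <= pi -> 1 - cos t <= t ^+ 2 / 2.
Proof.
move=> /andP[t0 tpi]; rewrite one_subr_cos.
have h1 := @sin_le_id (t / 2); have h2 : 0 <= sin (t / 2).
  by apply: sin_ge0_pi; apply/andP; split; have := pi_gt0 R; lra.
by have := h1 _; nra.
Qed.

End OneDim.

(** * One-dimensional factors of [V_k] *)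

Section GegenbauerWeight.
Variable R : realType.
Local Open Scope classical_set_scope.

Definition gw (k t : R) : R := (1 + t) * (1 - t ^+ 2) `^ (k - 1).

Lemma gw_ge0 (k t : R) : -1 <= t -> 0 <= gw k t.
Proof. by move=> t1; rewrite mulr_ge0 ?powR_ge0// -lerBlDl sub0r. Qed.

Lemma ck_ge0 (k : R) : 0 <= ck k.
Proof.
rewrite invr_ge0 fine_ge0//; apply: integral_ge0 => t.
by rewrite /I11 /= in_itv/= => /andP[t1 _]; rewrite lee_fin gw_ge0.
Qed.

Lemma JkE (k : R) phi : k != 0 -> Jk k phi =
  ((ck k)%:E * \int[lebesgue_measure]_(t in @I11 R) (phi t * (gw k t)%:E))%E.
Proof. by rewrite /Jk => /negbTE ->. Qed.

(** The weight [1 + t] is 0 at -1 and 2 at 1, so the limit functional is the point mass at 1. *)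
Lemma Jk0E (phi : R -> \bar R) : Jk 0 phi = phi 1.
Proof.
rewrite /Jk eqxx subrr mul0e adde0 muleA -EFinM.
by rewrite (_ : 1 / 2 * (1 + 1) = 1 :> R) ?mul1e//; field.
Qed.

Lemma Jk_monotone_on (k : R) : monotone_on (@I11 R) (Jk k).
Proof.
move=> phi psi pp; have [->|k0] := eqVneq k 0.
  by rewrite !Jk0E; apply: pp; rewrite /I11 /= in_itv/= lexx andbT; lra.
rewrite !JkE//; have c0 := ck_ge0 k; apply/andP; split.
  apply: mule_ge0; rewrite ?lee_fin//; apply: integral_ge0 => t It.
  apply: mule_ge0; first by case/andP: (pp t It).
  by move: It; rewrite /I11 /= in_itv/= => /andP[t1 _]; rewrite lee_fin gw_ge0.
apply: lee_wpmul2l; rewrite ?lee_fin//.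
have w0 t : @I11 R t -> (0 <= (gw k t)%:E)%E.
  by rewrite /I11 /= in_itv/= => /andP[t1 _]; rewrite lee_fin gw_ge0.
apply: ge0_integral_mono => // t It; have /andP[p0 p1] := pp t It.
  by apply: mule_ge0; [exact: le_trans p1|exact: w0].
apply/andP; split; first by apply: mule_ge0 => //; exact: w0.
by apply: lee_wpmul2r => //; exact: w0.
Qed.

(** The weight factors as [(1 + t)^k (1 - t)^(k - 1)], so only the endpoint 1 can be singular. *)
Lemma gw_le (k t rho : R) : 0 < k -> -1 <= t <= 1 -> 1 + t <= rho ->
  gw k t <= rho `^ k * (1 - t) `^ (k - 1).
Proof.
move=> k0 /andP[t1 t2] tr; have h : 0 <= 1 + t by lra.
rewrite /gw (_ : 1 - t ^+ 2 = (1 + t) * (1 - t)); last by ring.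
rewrite powRM//; last by lra.
rewrite mulrA mulr_powRB1//; apply: ler_wpM2r; first exact: powR_ge0.
by apply: ge0_ler_powR; rewrite ?nnegrE//; lra.
Qed.

(** On this interval [1 - t^2] lies between [b q / 2] and [2 b q]. The minimum covers both the
    increasing power [k >= 1] and the decreasing power [k < 1]. *)
Lemma gw_ge (k : R) (b q t : R) : 0 < b <= 1 -> 0 < q <= 1 ->
  1 - b * q <= t <= 1 - b * q / 2 ->
  Num.min ((b / 2) `^ (k - 1)) ((2 * b) `^ (k - 1)) * q `^ (k - 1) <= gw k t.
Proof.
move=> /andP[b0 b1] /andP[q0 q1] /andP[t1 t2].
have bq : b * q <= 1 by nra.
have bq0 : 0 < b * q by rewrite mulr_gt0.
rewrite /gw; apply: (@le_trans _ _ ((1 - t ^+ 2) `^ (k - 1))); last first.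
  by rewrite ler_peMl ?powR_ge0//; lra.
have h1 : 0 <= b / 2 by lra.
have h2 : 0 <= 2 * b by lra.
have h3 : 0 <= q by lra.
have l1 : b / 2 * q <= 1 - t ^+ 2 by nra.
have l2 : 1 - t ^+ 2 <= 2 * b * q by nra.
have [k1|k1] := leP 1 k.
  apply: (@le_trans _ _ ((b / 2 * q) `^ (k - 1))).
    rewrite (powRM _ h1 h3).
    by apply: ler_wpM2r; rewrite ?powR_ge0// ge_min lexx.
  by apply: ge0_ler_powR; rewrite ?nnegrE//; nra.
apply: (@le_trans _ _ ((2 * b * q) `^ (k - 1))).
  rewrite (powRM _ h2 h3).
  by apply: ler_wpM2r; rewrite ?powR_ge0// ge_min lexx orbT.
rewrite -(opprB 1 k) !powRN lef_pV2 ?posrE ?powR_gt0//; [|by nra|by nra].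
by apply: ge0_ler_powR; rewrite ?nnegrE//; nra.
Qed.

(** The bound [a] measures closeness to 1 and [rho] closeness to -1, so that one estimate serves
    both ends of the interval. *)
Lemma Jk_le_weight (k : R) (r a rho : R) (A : R -> bool) : 0 < k -> 0 <= r -> a < 1 ->
  (forall t, -1 <= t <= 1 -> A t -> a <= t /\ 1 + t <= rho) ->
  (Jk k (fun t => (if A t then r else 0)%:E) <=
   (r * (ck k * (rho `^ k * ((1 - a) `^ k / k))))%:E)%E.
Proof.
move=> k0 r0 a1 hA; rewrite JkE ?gt_eqF// mulrCA EFinM.
apply: lee_wpmul2l; first by rewrite lee_fin ck_ge0.
pose g t : \bar R := ((r * rho `^ k)%:E * ((1 - t) `^ (k - 1))%:E)%E.
have g0 t : (0 <= g t)%E by rewrite mule_ge0 ?lee_fin ?mulr_ge0 ?powR_ge0.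
apply: (@le_trans _ _ (\int[lebesgue_measure]_(t in `[a, 1%R]) g t)%E).
  rewrite [leRHS]integral_mkcond; apply: ge0_integral_mono => //.
    by move=> t _; rewrite patchE; case: ifP.
  move=> t; rewrite /I11 /= in_itv/= => It.
  have w0 : 0 <= gw k t by apply: gw_ge0; lra.
  rewrite -EFinM lee_fin; apply/andP; split.
    by rewrite mulr_ge0//; case: ifP.
  rewrite patchE; case: ifPn => [At|_]; last first.
    by rewrite mul0r; case: ifP.
  have [at_ tr] := hA t It At.
  rewrite mem_set/=; last by rewrite in_itv/= at_; lra.
  rewrite /g -EFinM lee_fin -mulrA; apply: ler_wpM2l => //.
  exact: gw_le.
rewrite -integral_itv_bndo_bndc; last first.
  apply: measurable_funTS; apply/measurable_EFinP/measurable_funM => //.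
  apply: (measurableT_comp (measurable_powR (k - 1))).
  exact: measurable_funB.
rewrite ge0_integralZl_EFin//; last 3 first.
- by move=> t _; rewrite lee_fin powR_ge0.
- apply: measurable_funTS; apply/measurable_EFinP.
  apply: (measurableT_comp (measurable_powR (k - 1))).
  exact: measurable_funB.
- by rewrite mulr_ge0 ?powR_ge0.
rewrite [leRHS](_ : _ = (r * rho `^ k)%:E * ((1 - a) `^ k / k)%:E)%E; last first.
  by rewrite -EFinM -mulrA.
apply: lee_wpmul2l.
  by rewrite lee_fin mulr_ge0 ?powR_ge0.
exact: integral_powR1B_le.
Qed.

(** For [s = 1] take [a = 1 - 18 q] and [rho = 2]; for [s = -1] take [a = -1] and [rho = 18 q].
    Either way the product of powers is [(36 q)^k]. *)
Lemma Jk_indicator_le (k s q r : R) : 0 <= k -> s ^+ 2 = 1 -> 0 < q <= 1 -> 0 <= r ->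
  (Jk k (fun t => (if (1 - s * t <= 18 * q)%R then r else 0)%:E) <=
   (r * ((if k == 0 then 1 else 36 `^ k / k) *
     ((if k == 0 then 1 else ck k) * q `^ k)))%:E)%E.
Proof.
move=> k0 /eqP s1 /andP[q0 q1] r0; case: eqVneq => [->|kn].
  by rewrite Jk0E powRr0 !mulr1 lee_fin; case: ifP.
have {k0 kn} k0 : 0 < k by rewrite lt_neqAle eq_sym kn.
have E36 : 36 `^ k = 2 `^ k * 18 `^ k :> R.
  by rewrite -powRM// -natrM.
have H1 : 1 - 18 * q < 1 by clear E36; lra.
have H2 : -1 < 1 :> R by lra.
move: s1; rewrite sqrf_eq1 => /orP[] /eqP ->.
- apply: (le_trans (@Jk_le_weight k r (1 - 18 * q) 2 _ k0 r0 H1 _)).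
    by clear E36 => t It /= At; split; lra.
  rewrite opprB addrC subrK lee_fin; apply: ler_wpM2l => //.
  by rewrite powRM ?(ltW q0)// E36 le_eqVlt; apply/orP; left; apply/eqP; ring.
- apply: (le_trans (@Jk_le_weight k r (-1) (18 * q) _ k0 r0 H2 _)).
    by clear E36 => t It /= At; split; lra.
  rewrite opprK lee_fin; apply: ler_wpM2l => //.
  by rewrite powRM ?(ltW q0)// E36 le_eqVlt; apply/orP; left; apply/eqP; ring.
Qed.

(** It suffices to integrate over [[1 - b q, 1 - b q / 2]], which stays away from the singularity:
    its length is [b q / 2] and the weight there is at least [m q^(k - 1)]. *)
Lemma Jk_indicator_ge (k b : R) : 0 <= k -> 0 < b <= 1 ->
  exists2 c : R, 0 < c & forall q r, 0 < q <= 1 -> 0 <= r ->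
  ((r * (c * ((if k == 0 then 1 else ck k) * q `^ k)))%:E <=
    Jk k (fun t => (if (1 - t <= b * q)%R then r else 0)%:E))%E.
Proof.
move=> k0 b01; have /andP[b0 b1] := b01; case: eqVneq => [->|kn].
  exists 1 => // q r /andP[q0 q1] r0; rewrite Jk0E powRr0 !mulr1 subrr.
  by rewrite mulr_ge0// ltW.
have {k0 kn} k0 : 0 < k by rewrite lt_neqAle eq_sym kn.
pose m := Num.min ((b / 2) `^ (k - 1)) ((2 * b) `^ (k - 1)).
have m0 : 0 < m by rewrite lt_min !powR_gt0//; lra.
exists (m * b / 2); first by rewrite divr_gt0// mulr_gt0.
move=> q r q01 r0; have /andP[q0 q1] := q01.
have bq0 : 0 < b * q by rewrite mulr_gt0.
have bq1 : b * q <= 1 by nra.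
rewrite JkE ?gt_eqF//.
pose v := r * (m * q `^ (k - 1)).
have v0 : 0 <= v by rewrite !mulr_ge0 ?powR_ge0// ltW.
rewrite (_ : r * _ = ck k * (v * (b * q / 2))); last first.
  by rewrite /v -(mulr_powRB1 (ltW q0) k0); field.
rewrite EFinM; apply: lee_wpmul2l; first by rewrite lee_fin ck_ge0.
have -> : (v * (b * q / 2))%:E =
    (\int[lebesgue_measure]_(t in `[(1 - b * q)%R, (1 - b * q / 2)%R]) (cst v%:E) t)%E.
  rewrite integral_cst//= lebesgue_measure_itv/= lte_fin ifT; last by lra.
  by rewrite -EFinD -EFinM; congr EFin; field.
have w0 t : @I11 R t -> 0 <= gw k t.
  by rewrite /I11 /= in_itv/= => /andP[t1 _]; exact: gw_ge0.
apply: ge0_integral_mono.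
- by move=> t; rewrite /I11 /= !in_itv/=; lra.
- move=> t It; rewrite -EFinM lee_fin mulr_ge0 ?w0//; by case: ifP.
- move=> t /=; rewrite in_itv/= => It; rewrite lee_fin v0/=.
  rewrite ifT; last by lra.
  by rewrite -EFinM lee_fin; apply: ler_wpM2l => //; exact: gw_ge.
Qed.

End GegenbauerWeight.

(** * Sphere integrals as cone integrals, and the upper bound on caps *)

Section SphereGeometry.
Variable R : realType.
Local Open Scope classical_set_scope.

Lemma dotp_vscale n (a : R) (x y : n.-tuple R) :
  dotp x (vscale a y) = a * dotp x y.
Proof.
by rewrite /dotp mulr_sumr; apply: eq_bigr => i _; rewrite tnth_mktuple mulrCA.
Qed.

Lemma dotpC n (x y : n.-tuple R) : dotp x y = dotp y x.
Proof. by apply: eq_bigr => i _; rewrite mulrC. Qed.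

Lemma dotp_ge0 n (x : n.-tuple R) : 0 <= dotp x x.
Proof. by apply: sumr_ge0 => i _; rewrite -expr2 sqr_ge0. Qed.

Lemma vnorm_sqr n (x : n.-tuple R) : vnorm x ^+ 2 = dotp x x.
Proof. by rewrite sqr_sqrtr ?dotp_ge0. Qed.

Lemma vscaleK n (a : R) (y : n.-tuple R) : a != 0 -> vscale a (vscale a^-1 y) = y.
Proof.
by move=> a0; apply: eq_from_tnth => i; rewrite !tnth_mktuple mulVKf.
Qed.

Lemma sphere_normalize d (y : d.+1.-tuple R) : 0 < vnorm y ->
  sphere R d (vscale (vnorm y)^-1 y).
Proof.
move=> y0; rewrite /sphere /= dotp_vscale dotpC dotp_vscale -vnorm_sqr expr2.
by rewrite mulKf ?mulVf ?gt_eqF.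
Qed.

(** In the cone formula the integrand at [y = r u] is [F u], so [G] has to dominate it along the
    whole ray up to radius 1. [G] will be a sum of functions constant on boxes. *)
Lemma sphere_int_le d (F G : d.+1.-tuple R -> \bar R) :
  (forall y, (0 <= G y)%E) ->
  (forall r u, 0 < r <= 1 -> sphere R d u -> (0 <= F u <= G (vscale r u))%E) ->
  (sphere_int F <= (d.+1)%:R%:E * leb_int G)%E.
Proof.
move=> G0 FG; apply: lee_wpmul2l => //.
set g := (X in (leb_int X <= _)%E).
suff : (0 <= leb_int g <= leb_int G)%E by case/andP.
apply: leb_int_mono => y; rewrite /g; case: ifPn => [/andP[y0 y1]|_].
  have := FG (vnorm y) (vscale (vnorm y)^-1 y).
  rewrite vscaleK ?gt_eqF// y0 y1; apply => //; exact: sphere_normalize.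
by rewrite lexx G0.
Qed.

Lemma sphere_int_ge d (F G : d.+1.-tuple R -> \bar R) :
  (forall y, (0 <= G y)%E) -> (forall u, sphere R d u -> (0 <= F u)%E) ->
  (forall y, G y != 0%E -> 0 < vnorm y <= 1 /\
    (G y <= F (vscale (vnorm y)^-1 y))%E) ->
  ((d.+1)%:R%:E * leb_int G <= sphere_int F)%E.
Proof.
move=> G0 F0 FG; apply: lee_wpmul2l => //.
set g := (X in (_ <= leb_int X)%E).
suff : (0 <= leb_int G <= leb_int g)%E by case/andP.
apply: leb_int_mono => y; rewrite G0 /=.
have [->|/FG[y01 Gy]] := eqVneq (G y) 0%E; last by rewrite /g y01.
by rewrite /g; case: ifPn => // /andP[y0 _]; exact/F0/sphere_normalize.
Qed.

Lemma dist_sphere d (x u : d.+1.-tuple R) : sphere R d x -> sphere R d u ->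
  \sum_(i < d.+1) (tnth u i - tnth x i) ^+ 2 = 2 * (1 - dotp x u).
Proof.
rewrite /sphere /= => x1 u1.
transitivity (dotp u u + dotp x x - 2 * dotp x u).
  rewrite /dotp mulr_sumr -big_split -sumrB /=; apply: eq_bigr => i _; ring.
by rewrite x1 u1; ring.
Qed.

Lemma coord_dist_sphere d (x u : d.+1.-tuple R) (t : R) i :
  sphere R d x -> sphere R d u -> 0 <= t -> 2 * (1 - dotp x u) <= t ^+ 2 ->
  `|tnth u i - tnth x i| <= t.
Proof.
move=> x1 u1 t0; rewrite -dist_sphere// (bigD1 i)//= => h.
rewrite -(ger0_norm t0) -ler_sqr ?normr_nneg// -!normrX !ger0_norm ?sqr_ge0//.
by apply: le_trans h; rewrite lerDl sumr_ge0// => j _; rewrite sqr_ge0.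
Qed.

Lemma sphere_coord_le1 d (x : d.+1.-tuple R) i : sphere R d x -> `|tnth x i| <= 1.
Proof.
rewrite /sphere /= /dotp => x1.
rewrite -[leRHS]normr1 -ler_sqr ?normr_nneg// -!normrX !ger0_norm ?sqr_ge0//.
rewrite expr1n -x1 (bigD1 i)//= -expr2 lerDl sumr_ge0// => j _.
by rewrite -expr2 sqr_ge0.
Qed.

Definition cbox (c : nat -> R) (h : R) (v : R) n : n.-tuple R -> \bar R :=
  box_cst (fun i t => `|t - c i| <= h) v (n := n).

Lemma leb_int_sum_cbox n (I : finType) (c : I -> nat -> R) (h v : R) :
  0 <= h -> 0 <= v ->
  leb_int (fun y : n.-tuple R => (\sum_(m : I) cbox (c m) h v y)%E) =
  (#|I|%:R * (v * (2 * h) ^+ n))%:E.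
Proof.
move=> h0 v0; rewrite leb_int_sum.
- under eq_bigr do rewrite (@leb_int_box R n _ (fun=> h))//.
  by rewrite sumEFin sumr_const prodr_const card_ord -(mulr_natl (v * _)).
- by move=> m; exact: (@measurable_box_cst R (c m) (fun=> h) v n).
- by move=> m y; rewrite /cbox /box_cst; case: ifP => // _; rewrite lee_fin.
Qed.

(* A point [r u] of the cone over the cap is within [2 t] of [m t x] in every
   coordinate, where [m] is the integer part of [r / t]. *)
Lemma sphere_int_cap_le d (x : d.+1.-tuple R) (t v : R) F :
  sphere R d x -> 0 < t <= pi -> 0 <= v ->
  (forall u, sphere R d u -> (0 <= F u)%E) ->
  (forall u, sphere R d u -> cos t <= dotp x u -> (F u <= v%:E)%E) ->
  (forall u, sphere R d u -> dotp x u < cos t -> F u = 0%E) ->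
  (sphere_int F <= (d.+1%:R * ((1 + pi) * 4 ^+ d.+1) * (v * t ^+ d))%:E)%E.
Proof.
move=> x1 t0pi v0 F0 Fv Fz; have /andP[t0 tpi] := t0pi.
(* As [r <= 1], the index of a box never exceeds [N]. The [N + 1 <= (1 + pi) / t] cubes of side
   [4 t] have total volume at most [(1 + pi) 4^(d+1) t^d]. *)
pose N := Num.truncn (t^-1).
pose c (m : 'I_N.+1) i := m%:R * t * nth 0 x i.
have cb0 m (y : d.+1.-tuple R) : (0 <= cbox (c m) (2 * t) v y)%E.
  by rewrite /cbox /box_cst; case: ifP => // _; rewrite lee_fin.
pose G (y : d.+1.-tuple R) := (\sum_m cbox (c m) (2 * t) v y)%E.
have G0 y : (0 <= G y)%E by apply: sume_ge0 => m _; exact: cb0.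
apply: le_trans (@sphere_int_le d F G G0 _) _; last first.
  rewrite leb_int_sum_cbox ?mulr_ge0 ?(ltW t0)// -EFinM lee_fin card_ord.
  pose Q : R := 4 ^+ d.+1 * (v * t ^+ d).
  have Q0 : 0 <= Q by rewrite !mulr_ge0 ?exprn_ge0// ltW.
  have Nt : N.+1%:R * t <= 1 + pi.
    rewrite -natr1 mulrDl mul1r lerD// -ler_pdivlMr// div1r.
    by rewrite truncn_le invr_ge0 ltW.
  have -> : v * (2 * (2 * t)) ^+ d.+1 = t * Q.
    rewrite /Q (_ : 2 * (2 * t) = 4 * t); last by ring.
    by rewrite exprMn [t ^+ d.+1]exprS; move: (4 ^+ d.+1) (t ^+ d) => ? ?; ring.
  rewrite -mulrA ler_wpM2l// mulrA [leRHS](_ : _ = (1 + pi) * Q).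
    exact: ler_wpM2r.
  by rewrite /Q -mulrA.
move=> r u /andP[r0 r1] u1; rewrite F0//=.
have [cu|/Fz ->] := leP (cos t) (dotp x u); [|exact: G0|by []].
apply: (le_trans (Fv _ u1 cu)).
have rt0 : 0 <= r / t by apply: divr_ge0; exact: ltW.
have mN : (Num.truncn (r / t) < N.+1)%N.
  by rewrite ltnS le_truncn// ler_piMl// invr_ge0 ltW.
rewrite /G (bigD1 (Ordinal mN))//= -[leLHS]adde0; apply: leeD; last first.
  by apply: sume_ge0 => m _; exact: cb0.
rewrite /cbox /box_cst; case: (in_boxP _ (vscale r u)) => // -[].
move=> i; rewrite /c /= -tnth_nth tnth_mktuple.
set m := Num.truncn _.
have /andP[m1 m2] : m%:R <= r / t < m.+1%:R by exact: truncn_itv.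
have ui : `|tnth u i - tnth x i| <= t.
  apply: coord_dist_sphere => //; first exact: ltW.
  by have := one_subr_cos_le t0pi; lra.
have xi := @sphere_coord_le1 _ _ i x1.
rewrite ler_pdivlMr// in m1; rewrite ltr_pdivrMr// -natr1 in m2.
(* Each summand is at most [t]: the first by the angular distance, the second because [r - m t < t]
   and [|x_i| <= 1]. *)
rewrite (_ : _ - _ = r * (tnth u i - tnth x i) + (r - m%:R * t) * tnth x i);
  last by ring.
apply: (le_trans (ler_normD _ _)); rewrite !normrM.
have -> : `|r| = r by rewrite gtr0_norm.
have -> : `|r - m%:R * t| = r - m%:R * t by rewrite ger0_norm; lra.
have := normr_ge0 (tnth x i); have := normr_ge0 (tnth u i - tnth x i).
nra.
Qed.

End SphereGeometry.

(** * The lower bound on caps, by packing boxes *)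

Section LowerBoxes.
Variable R : realType.
Local Open Scope classical_set_scope.

(* Moves [x] away from [0] by [s], so that [h_k] is large on boxes around the
   resulting centre. *)
Definition pushed (s x : R) : R := if 0 <= x then x + s else x - s.

Lemma norm_pushed (s x : R) : 0 <= s -> `|pushed s x| = `|x| + s.
Proof.
move=> s0; rewrite /pushed; case: leP => x0.
  by rewrite !ger0_norm ?addr_ge0.
by rewrite !ltr0_norm//; lra.
Qed.

Lemma norm_pushedB (s x : R) : 0 <= s -> `|pushed s x - x| = s.
Proof.
move=> s0; rewrite /pushed; case: leP => x0.
  by rewrite addrC addKr ger0_norm.
by rewrite addrC addKr normrN ger0_norm.
Qed.

(** The push [4 e t] beats the half-side [e t]: from [r >= 1/2], [|y| >= |x|/2 + 2 e t - e t]; from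
    [r <= 3/4], the displacement is at most [e t + 3 e t]. *)
Lemma pushed_box_coord (x y r t e : R) :
  0 <= e <= 1 / 2 -> 0 <= t -> 1 / 2 <= r <= 3 / 4 ->
  `|y - r * pushed (4 * e * t) x| <= e * t ->
  `|y - r * x| <= 4 * e * t /\ e * (`|x| + t) <= `|y|.
Proof.
move=> /andP[e0 e1] t0 /andP[r1 r2] h.
have et : 0 <= e * t by rewrite mulr_ge0.
have s0 : 0 <= 4 * e * t by lra.
have h1 := norm_pushed x s0; have h2 := norm_pushedB x s0; split.
  rewrite (_ : y - r * x = (y - r * pushed (4 * e * t) x) +
    r * (pushed (4 * e * t) x - x)); last by ring.
  apply: (le_trans (ler_normD _ _)).
  by rewrite normrM h2 (ger0_norm (_ : 0 <= r)); nra.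
have : r * (`|x| + 4 * e * t) <= `|y| + e * t.
  rewrite -h1 -{1}(ger0_norm (_ : 0 <= r)); last by lra.
  rewrite -normrM (_ : r * _ = y - (y - r * pushed (4 * e * t) x)); last by ring.
  by apply: (le_trans (ler_normB _ _)); rewrite lerD2l.
have := normr_ge0 x; nra.
Qed.

(** With [y = r x + w], the first-order term [E1 = x.w] changes [|y|] and [x.y] alike, so
    [|y| - x.y] is controlled by [E2 = |w|^2], which is of order [t^2]. The scale [b / (160 n)]
    gives [|E1| <= b t / 40] and [E2 <= (b t)^2 / 1600]. *)
Lemma pushed_box_sphere d (x y : d.+1.-tuple R) (r t b : R) :
  sphere R d x -> 0 < t <= 4 -> 0 < b <= 1 -> 1 / 2 <= r <= 3 / 4 ->
  (forall i, `|tnth y i - r * tnth x i| <= 4 * (b / (160 * d.+1%:R)) * t) ->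
  0 < vnorm y <= 1 /\ 1 - dotp x (vscale (vnorm y)^-1 y) <= b * t ^+ 2.
Proof.
move=> x1 /andP[t0 t4] /andP[b0 b1] /andP[r1 r2] hy.
pose n : R := d.+1%:R; pose e := b / (160 * n).
have n1 : 1 <= n by rewrite /n ler1n.
have en : e * n = b / 160 by rewrite /e; field; lra.
have e0 : 0 < e by rewrite /e divr_gt0//; lra.
pose E1 := \sum_(i < d.+1) tnth x i * (tnth y i - r * tnth x i).
pose E2 := \sum_(i < d.+1) (tnth y i - r * tnth x i) ^+ 2.
have E20 : 0 <= E2 by apply: sumr_ge0 => i _; exact: sqr_ge0.
have bt : 0 < b * t by rewrite mulr_gt0.
have hE1 : `|E1| <= b * t / 40.
  apply: (le_trans (ler_norm_sum _ _ _)).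
  apply: (@le_trans _ _ (\sum_(i < d.+1) 4 * e * t)).
    apply: ler_sum => i _; rewrite normrM.
    have := sphere_coord_le1 i x1; have := hy i; rewrite -/n -/e.
    have := normr_ge0 (tnth x i); have := normr_ge0 (tnth y i - r * tnth x i).
    nra.
  rewrite sumr_const card_ord -[leLHS]mulr_natr -/n.
  rewrite (_ : 4 * e * t * n = 4 * (e * n) * t); last by ring.
  by rewrite en; lra.
have hE2 : E2 <= b * t * (b * t) / 1600.
  apply: (@le_trans _ _ (\sum_(i < d.+1) (4 * e * t) ^+ 2)).
    apply: ler_sum => i _; rewrite -(ger0_norm (sqr_ge0 _)) normrX.
    by apply: lerXn2r; rewrite ?nnegrE//; nra.
  rewrite sumr_const card_ord -[leLHS]mulr_natr -/n.
  rewrite (_ : (4 * e * t) ^+ 2 * n = 16 * (e * n) * (e * t * t)); last by ring.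
  rewrite en; have : e <= b / 160 by nra.
  by nra.
have Dxy : dotp x y = r + E1.
  transitivity (r * dotp x x + E1); last by rewrite x1 mulr1.
  by rewrite /dotp mulr_sumr -big_split/=; apply: eq_bigr => i _; ring.
have Dyy : dotp y y = r ^+ 2 + 2 * r * E1 + E2.
  transitivity (r ^+ 2 * dotp x x + 2 * r * E1 + E2); last by rewrite x1 mulr1.
  by rewrite /dotp !mulr_sumr -!big_split/=; apply: eq_bigr => i _; ring.
have N2 := vnorm_sqr y; rewrite Dyy in N2.
have /andP[E1l E1u] : - (b * t / 40) <= E1 <= b * t / 40 by rewrite -ler_norml.
have bt4 : b * t <= 4 by nra.
have N0 : 0 <= vnorm y by exact: sqrtr_ge0.
set N := vnorm y in N2 N0 *.
have E2s : E2 <= b * t ^+ 2 / 1600 by nra.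
have N41 : 1 / 4 <= N.
  by rewrite -(@ler_pXn2r _ 2) ?nnegrE//; nra.
have N11 : N <= 1.
  by rewrite -(@ler_pXn2r _ 2) ?nnegrE// expr1n; nra.
split; first by apply/andP; split; lra.
rewrite dotp_vscale Dxy mulrC -/N.
have NK : (r + E1) / N * N = r + E1 by rewrite divfK//; lra.
set q := (r + E1) / N in NK *.
have p0 : 2 / 5 <= r + E1 by lra.
(* The left side equals [E2 - E1 ^+ 2]. *)
have NN : (N - (r + E1)) * (N + (r + E1)) <= E2 by nra.
have bt2 : 0 <= b * t ^+ 2 by nra.
have key : N - (r + E1) <= b * t ^+ 2 / 4.
  by rewrite leNgt; apply/negP => hlt; nra.
have : (1 - q) * N <= b * t ^+ 2 / 4 by rewrite mulrBl NK mul1r.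
by rewrite leNgt => hh; rewrite leNgt; apply/negP => hlt; move/negP: hh; apply; nra.
Qed.

(** A common point forces [(r' - r) |z_i| <= 2 e t] for each coordinate of the pushed centre [z],
    hence [|x_i| <= |z_i| <= 1 / (2 n)] for all [i], which is too small for a unit vector. *)
Lemma pushed_boxes_disjoint d (x y : d.+1.-tuple R) (r r' t e : R) :
  sphere R d x -> 0 < t -> 0 < e -> 4 * e * d.+1%:R * t <= r' - r ->
  ~ forall i, `|tnth y i - r * pushed (4 * e * t) (tnth x i)| <= e * t /\
    `|tnth y i - r' * pushed (4 * e * t) (tnth x i)| <= e * t.
Proof.
move=> x1 t0 e0 rr h.
pose n : R := d.+1%:R.
have n1 : 1 <= n by rewrite /n ler1n.
have et : 0 < e * t by rewrite mulr_gt0.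
have hx i : tnth x i ^+ 2 <= 1 / (4 * n).
  have [h1 h2] := h i; set z := pushed _ _ in h1 h2.
  have zx : `|tnth x i| <= `|z| by rewrite norm_pushed; lra.
  have : (r' - r) * `|z| <= 2 * (e * t).
    rewrite -(ger0_norm (_ : 0 <= r' - r)); last by apply: le_trans rr; nra.
    rewrite -normrM (_ : _ * z = (tnth y i - r * z) - (tnth y i - r' * z));
      last by ring.
    by apply: (le_trans (ler_normB _ _)); lra.
  have z0 := normr_ge0 z; have X0 := normr_ge0 (tnth x i).
  have : 4 * e * n * t * `|z| <= (r' - r) * `|z| by apply: ler_wpM2r.
  move=> k1 k2; have k3 : (2 * n) * `|z| <= 1.
    rewrite -(ler_pM2l et); nra.
  have k4 : (2 * n) * `|tnth x i| <= 1 by nra.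
  rewrite -(ger0_norm (sqr_ge0 _)) normrX ler_pdivlMr; last by lra.
  by nra.
have : dotp x x <= \sum_(i < d.+1) 1 / (4 * n).
  by apply: ler_sum => i _; rewrite -expr2; exact: hx.
rewrite sumr_const card_ord -[leRHS]mulr_natr -/n x1.
by rewrite (_ : 1 / (4 * n) * n = 1 / 4); [lra|field; lra].
Qed.

(* The boxes are centred at [r_m z], with [z] the pushed [x] and
   [r_m = 1/2 + 4 e (d+1) t m <= 3/4]. *)
Lemma sphere_int_cap_ge d (b : R) : 0 < b <= 1 ->
  exists e c : R, [/\ 0 < e, 0 < c & forall (x : d.+1.-tuple R) (t v : R) F,
  sphere R d x -> 0 < t <= pi -> 0 <= v ->
  (forall u, sphere R d u -> (0 <= F u)%E) ->
  (forall u, sphere R d u -> 1 - dotp x u <= b * t ^+ 2 ->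
    (forall i, e * (`|tnth x i| + t) <= `|tnth u i|) -> (v%:E <= F u)%E) ->
  ((c * (v * t ^+ d))%:E <= sphere_int F)%E].
Proof.
move=> b01; have /andP[b0 b1] := b01.
(* [e] is the scale required by [pushed_box_sphere], and [rho * t] the radial step required by
   [pushed_boxes_disjoint]. *)
pose n : R := d.+1%:R; pose e := b / (160 * n); pose rho := 4 * e * n.
have n1 : 1 <= n by rewrite /n ler1n.
have e0 : 0 < e by rewrite /e divr_gt0//; lra.
have e1 : e <= 1 / 2.
  by rewrite /e ler_pdivrMr; [nra|lra].
have rho0 : 0 < rho by rewrite /rho; clear -e0 n1; nra.
exists e, (n * ((2 * e) ^+ d.+1 / (4 * rho))); split => //.
  apply: mulr_gt0; first by lra.
  by apply: divr_gt0; [apply: exprn_gt0; lra|lra].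
move=> x t v F x1 /andP[t0 tpi] v0 F0 Fv.
have t4 : t <= 4 by have := pihalf_lt2 R; lra.
have rt0 : 0 < rho * t by rewrite mulr_gt0.
(* [M] is the last index with [r m <= 3 / 4]. Since [(M + 1) t >= 1 / (4 rho)], the boxes of volume
   [(2 e t)^(d+1)] have total volume at least a constant times [t^d]. *)
pose M := Num.truncn (1 / 4 / (rho * t)).
pose r m : R := 1 / 2 + m%:R * (rho * t).
have r1 m : 1 / 2 <= r m by rewrite lerDl mulr_ge0// ltW.
have r2 m : (m <= M)%N -> r m <= 3 / 4.
  move=> mM; have : m%:R * (rho * t) <= 1 / 4.
    rewrite -ler_pdivlMr//; apply: (@le_trans _ _ M%:R); first by rewrite ler_nat.
    by rewrite truncn_le; apply: divr_ge0; lra.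
  by rewrite /r; lra.
pose c (m : 'I_M.+1) i := r m * pushed (4 * e * t) (nth 0 x i).
have et0 : 0 <= e * t by rewrite mulr_ge0// ltW.
pose G (y : d.+1.-tuple R) := (\sum_m cbox (c m) (e * t) v y)%E.
have cb0 m (y : d.+1.-tuple R) : (0 <= cbox (c m) (e * t) v y)%E.
  by rewrite /cbox /box_cst; case: ifP => // _; rewrite lee_fin.
have G0 y : (0 <= G y)%E by apply: sume_ge0 => m _; exact: cb0.
apply: le_trans (@sphere_int_ge _ d F G G0 F0 _).
  rewrite leb_int_sum_cbox// -EFinM lee_fin card_ord -/n.
  have MS : 1 / (4 * rho) <= M.+1%:R * t.
    have := truncnS_gt (1 / 4 / (rho * t)); rewrite -/M ltr_pdivrMr// => h.
    by rewrite ler_pdivrMr; lra.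
  pose Q := (2 * e) ^+ d.+1 * (v * t ^+ d).
  have Q0 : 0 <= Q.
    apply: mulr_ge0; first by apply: exprn_ge0; lra.
    by apply: mulr_ge0 => //; apply: exprn_ge0; lra.
  have -> : v * (2 * (e * t)) ^+ d.+1 = t * Q.
    rewrite /Q (_ : 2 * (e * t) = 2 * e * t); last by ring.
    by rewrite exprMn [t ^+ d.+1]exprS; move: ((2 * e) ^+ d.+1) (t ^+ d) => ? ?; ring.
  rewrite -mulrA; apply: ler_wpM2l; first by lra.
  rewrite [leRHS]mulrA [leLHS](_ : _ = 1 / (4 * rho) * Q); first exact: ler_wpM2r.
  by rewrite /Q; move: ((2 * e) ^+ d.+1) (t ^+ d) => ? ?; ring.
move=> y Gy.
have [m0 ym0] : exists m, in_box (fun i u => `|u - c m i| <= e * t) y.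
  apply/existsP; apply: contraNT Gy; rewrite negb_exists => /forallP h.
  apply/eqP; apply: big1 => m _; rewrite /cbox /box_cst.
  by rewrite (negbTE (h m)).
have hm m : in_box (fun i u => `|u - c m i| <= e * t) y ->
    forall i, `|tnth y i - r m * pushed (4 * e * t) (tnth x i)| <= e * t.
  by move=> /in_boxP h i; have := h i; rewrite /c -tnth_nth.
(* By disjointness only one term of the sum is active, so [G] does not exceed [v]. *)
have Gv : G y = v%:E.
  rewrite /G (bigD1 m0)//= {1}/cbox /box_cst ym0 big1 ?adde0// => m mm0.
  rewrite /cbox /box_cst; case: ifP => // ym.
  have step (m1 m2 : 'I_M.+1) : (m1 < m2)%N ->
      4 * e * d.+1%:R * t <= r m2 - r m1.
    move=> m12; rewrite /r -/n -/rho.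
    have : (m1.+1)%:R <= m2%:R :> R by rewrite ler_nat.
    by rewrite -natr1; nra.
  exfalso; have [lt|lt|eq] := ltngtP m m0.
  - apply: (pushed_boxes_disjoint x1 t0 e0 (step _ _ lt) (y := y)) => i.
    by split; [exact: (hm m ym)|exact: (hm m0 ym0)].
  - apply: (pushed_boxes_disjoint x1 t0 e0 (step _ _ lt) (y := y)) => i.
    by split; [exact: (hm m0 ym0)|exact: (hm m ym)].
  - by move/eqP: mm0; apply; apply: val_inj.
have rm : 1 / 2 <= r m0 <= 3 / 4 by rewrite r1 r2// -ltnS.
have co i := @pushed_box_coord (tnth x i) (tnth y i) (r m0) t e
  (introT andP (conj (ltW e0) e1)) (ltW t0) rm (hm m0 ym0 i).
have t04 : 0 < t <= 4 by rewrite t0.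
have [y01 dy] := pushed_box_sphere x1 t04 b01 rm (fun i => (co i).1).
split => //; have /andP[y0 y1] := y01.
rewrite Gv; apply: Fv => //; first exact: sphere_normalize.
(* Normalizing only enlarges the coordinates, because [|y| <= 1]. *)
move=> i; apply: (le_trans (co i).2); rewrite tnth_mktuple normrM.
rewrite ler_peMl// ger0_norm ?invr_ge0 ?(ltW y0)//.
by rewrite invf_ge1.
Qed.

End LowerBoxes.

(** * Pointwise bounds for [V_k] of the indicator and for [h_k] *)

Section Intertwining.
Variable R : realType.
Local Open Scope classical_set_scope.

Definition relrad (t x : R) : R := t ^+ 2 / (`|x| + t) ^+ 2.

Lemma relrad_gt0_le1 (t x : R) : 0 < t -> 0 < relrad t x <= 1.
Proof.
move=> t0; have x0 := normr_ge0 x; apply/andP; split.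
  by apply: divr_gt0; apply: exprn_gt0 => //; lra.
rewrite ler_pdivrMr ?mul1r; last by apply: exprn_gt0; lra.
by apply: lerXn2r; rewrite ?nnegrE; lra.
Qed.

(* Up to constants, the value of the one-dimensional factor of [V_k] at the
   indicator of [1 - tau <= relrad t x].  Keeping [ck k] as a factor avoids
   proving that its defining integral is finite. *)
Definition wfactor (k t x : R) : R :=
  (if k == 0 then 1 else ck k) * relrad t x `^ k.

Lemma wfactor_ge0 (k t x : R) : 0 <= wfactor k t x.
Proof. by rewrite mulr_ge0 ?powR_ge0//; case: ifP => // _; exact: ck_ge0. Qed.

(** If [x <= 2 t], the right side is at least [18 / 9 = 2]; this is the origin of 18. Otherwise
    [u >= x / 2], so [x^2 g <= t^2], and [x + t <= 3 x / 2]. *)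
Lemma relrad_bound (t x u g : R) : 0 < t -> 0 <= x -> 0 <= u -> `|u - x| <= t ->
  0 <= g <= 2 -> x * u * g <= t ^+ 2 / 2 -> g <= 18 * (t ^+ 2 / (x + t) ^+ 2).
Proof.
move=> t0 x0 u0; rewrite ler_norml => /andP[ux1 ux2] /andP[g0 g2] h.
have xt0 : 0 < (x + t) ^+ 2 by apply: exprn_gt0; lra.
rewrite mulrA ler_pdivlMr//.
have [xt|xt] := leP x (2 * t).
  have : (x + t) ^+ 2 <= (3 * t) ^+ 2 by apply: lerXn2r; rewrite ?nnegrE; lra.
  by nra.
have h1 : x * (x / 2) * g <= t ^+ 2 / 2.
  by apply: le_trans h; apply: ler_wpM2r => //; apply: ler_wpM2l => //; lra.
have : (x + t) ^+ 2 <= (3 / 2 * x) ^+ 2 by apply: lerXn2r; rewrite ?nnegrE; lra.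
move=> /(ler_wpM2l g0); nra.
Qed.

Lemma Vk_ge0 d (k : d.+1.-tuple R) x t u : (0 <= Vk k (chiB x t) u)%E.
Proof.
apply: (@iterint_ge0 R (@I11 R)) => [i|y _]; first exact: Jk_monotone_on.
by rewrite /chiB; case: ifP.
Qed.

(** With [x' = reflect_by e x] one has [x.(u tau) = x'.u - sum x'_i u_i (1 - s_i tau_i)], where all
    terms of the sum are nonnegative. If this is at least [cos t], then [x'.u >= cos t] and each
    term is at most [1 - cos t <= t^2 / 2], so [relrad_bound] confines [tau] to a box. *)
Lemma Vk_chiB_le d (k : d.+1.-tuple R) : (forall i, 0 <= tnth k i) ->
  exists2 C : R, 0 < C & forall (e : d.+1.-tuple bool) (x u : d.+1.-tuple R) (t : R),
  sphere R d x -> sphere R d (reflect_by e x) -> sphere R d u -> 0 < t <= pi ->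
  (forall i, 0 <= tnth (reflect_by e x) i * tnth u i) ->
  (Vk k (chiB x t) u <=
   (if (cos t <= dotp (reflect_by e x) u)%R
    then C * \prod_(i < d.+1) wfactor (tnth k i) t (tnth x i) else 0)%:E)%E.
Proof.
move=> k0.
(* The functionals of an iterated integral are indexed by all naturals. Past the end the defaults
   are exponent 0 and, in [s] below, sign 1. *)
have k0' i : 0 <= nth 0 k i.
  have [id|id] := ltnP i d.+1; first by have := k0 (Ordinal id); rewrite (tnth_nth 0).
  by rewrite nth_default// size_tuple.
pose Ci i : R := if nth 0 k i == 0 then 1 else 36 `^ (nth 0 k i) / nth 0 k i.
have Ci0 i : 0 < Ci i.
  rewrite /Ci; case: eqVneq => // kn; rewrite divr_gt0 ?powR_gt0//.
  by rewrite lt_neqAle eq_sym kn k0'.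
exists (\prod_(i < d.+1) Ci i); first exact: prodr_gt0.
move=> e x u t x1 x'1 u1 tpi sg; have /andP[t0 _] := tpi.
set x' := reflect_by e x in x'1 sg *.
pose s i : R := if nth false e i then -1 else 1.
have ss i : s i ^+ 2 = 1 by rewrite /s; case: ifP; rewrite ?sqrrN expr1n.
have xs (i : 'I_d.+1) : tnth x i = s i * tnth x' i.
  rewrite tnth_mktuple (tnth_nth false e) /s.
  by case: ifP => _; rewrite ?mulN1r ?opprK ?mul1r.
have nx (i : 'I_d.+1) : `|tnth x i| = `|tnth x' i|.
  by rewrite xs normrM /s; case: ifP => _; rewrite ?normrN normr1 mul1r.
pose A i (r : R) := 1 - s i * r <= 18 * relrad t (nth 0 x i).
pose b i : R := Ci i * wfactor (nth 0 k i) t (nth 0 x i).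
have b0 i : 0 <= b i by apply: mulr_ge0; [exact: ltW|exact: wfactor_ge0].
(* The value on the box depends on [u] alone and vanishes off the reflected cap. *)
pose a : R := if cos t <= dotp x' u then 1 else 0.
have a0 : 0 <= a by rewrite /a; case: ifP.
have := @iterint_box_le R (@I11 R) d.+1 (fun i => Jk (nth 0 k i)) A b a
  (fun i => @Jk_monotone_on R _) b0 _ a0.
have -> : a * \prod_(i < d.+1) b i = if cos t <= dotp x' u then
    \prod_(i < d.+1) Ci i * \prod_(i < d.+1) wfactor (tnth k i) t (tnth x i) else 0.
  rewrite /a; case: ifP => _; rewrite ?mul0r// mul1r -big_split/=.
  by apply: eq_bigr => i _; rewrite /b !(tnth_nth 0).
move=> H; apply: le_trans (H _); last first.
  by move=> i r r0; apply: Jk_indicator_le => //; exact: relrad_gt0_le1.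
set g := (X in (iterint _ X <= _)%E).
suff : (0 <= iterint (fun i => Jk (nth 0%R k i)) g <=
   iterint (fun i => Jk (nth 0%R k i)) (@box_cst R A a d.+1))%E by case/andP.
apply: (@iterint_mono R (@I11 R)) => [i|y Sy]; first exact: Jk_monotone_on.
rewrite /g /chiB; case: ifPn => [/andP[_ hc]|_]; last first.
  by rewrite lexx/= /box_cst; case: ifP => // _; rewrite lee_fin.
have Sy' i : -1 <= tnth y i <= 1 by have := Sy i; rewrite /I11/= in_itv.
have sy (i : 'I_d.+1) : 0 <= 1 - s i * tnth y i <= 2.
  by have := Sy' i; rewrite /s; case: ifP => _; lra.
have xu (i : 'I_d.+1) : tnth x i * (tnth u i * tnth y i) =
    tnth x' i * tnth u i - (tnth x' i * tnth u i) * (1 - s i * tnth y i).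
  by rewrite xs; ring.
have xu1 : dotp x' u <= 1.
  rewrite -subr_ge0 -(@pmulr_rge0 _ 2)// -dist_sphere//.
  by apply: sumr_ge0 => i _; exact: sqr_ge0.
have hsum : \sum_(i < d.+1) (tnth x' i * tnth u i) * (1 - s i * tnth y i) <=
    dotp x' u - cos t.
  rewrite lerBrDr addrC -lerBrDr; apply: (le_trans hc).
  rewrite /dotp -sumrB; apply: ler_sum => i _.
  by rewrite tnth_mktuple xu.
have term0 (i : 'I_d.+1) : 0 <= (tnth x' i * tnth u i) * (1 - s i * tnth y i).
  by apply: mulr_ge0; [exact: sg|case/andP: (sy i)].
have cu : cos t <= dotp x' u.
  by rewrite -subr_ge0; apply: le_trans hsum; apply: sumr_ge0 => i _; exact: term0.
rewrite lee_fin ler01 /= /box_cst /a cu; case: (in_boxP _ y) => // -[] i.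
rewrite /A -tnth_nth.
have ct := one_subr_cos_le tpi.
have ux : `|tnth u i - tnth x' i| <= t.
  by apply: coord_dist_sphere => //; [exact: ltW|lra].
rewrite /relrad nx; apply: (@relrad_bound t `|tnth x' i| `|tnth u i|) => //.
- by apply: le_trans ux; exact: ler_dist_dist.
- rewrite -normrM ger0_norm ?sg//.
  apply: (@le_trans _ _ (dotp x' u - cos t)); last by lra.
  apply: le_trans hsum; rewrite (bigD1 i)//= lerDl.
  by apply: sumr_ge0 => j _; exact: term0.
Qed.

(** For [tau] in the box [1 - tau_i <= be q_i], the estimate [x_i u_i <= (|x_i| + t)^2] cancels the
    denominator of [q_i], so replacing [u] by [u tau] costs at most [b t^2] in the inner product. *)
Lemma Vk_chiB_ge d (k : d.+1.-tuple R) (b : R) : (forall i, 0 <= tnth k i) ->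
  0 < b <= 1 / 2 ->
  exists2 c : R, 0 < c & forall (x u : d.+1.-tuple R) (t : R),
  sphere R d x -> sphere R d u -> 0 < t -> 2 * b * t ^+ 2 <= 1 - cos t ->
  1 - dotp x u <= b * t ^+ 2 ->
  ((c * \prod_(i < d.+1) wfactor (tnth k i) t (tnth x i))%:E <=
   Vk k (chiB x t) u)%E.
Proof.
move=> k0 /andP[b0 b1].
pose n : R := d.+1%:R.
have n1 : 1 <= n by rewrite /n ler1n.
(* The loss [b t^2] is divided evenly among the [n] coordinates. *)
pose be := b / n.
have be01 : 0 < be <= 1.
  by rewrite /be divr_gt0 ?ler_pdivrMr ?mul1r//=; lra.
have be0 : 0 <= be by case/andP: be01 => /ltW.
have k0' i : 0 <= nth 0 k i.
  have [id|id] := ltnP i d.+1; first by have := k0 (Ordinal id); rewrite (tnth_nth 0).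
  by rewrite nth_default// size_tuple.
have ex i : exists c : R, 0 < c /\ forall q r, 0 < q <= 1 -> 0 <= r ->
  ((r * (c * ((if nth 0%R k i == 0%R then 1 else ck (nth 0%R k i)) * q `^ (nth 0%R k i))))%:E <=
    Jk (nth 0%R k i) (fun t => (if (1 - t <= be * q)%R then r else 0)%:E))%E.
  by have [c c0 hc] := Jk_indicator_ge (k0' i) be01; exists c.
have [c hc] := choice ex.
exists (\prod_(i < d.+1) c i); first by apply: prodr_gt0 => i _; case: (hc i).
move=> x u t x1 u1 t0 bt xu.
pose A i (r : R) := 1 - r <= be * relrad t (nth 0 x i).
pose bb i : R := c i * wfactor (nth 0 k i) t (nth 0 x i).
have bb0 i : 0 <= bb i.
  by apply: mulr_ge0; [apply: ltW; case: (hc i)|exact: wfactor_ge0].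
have := @iterint_box_ge R (@I11 R) d.+1 (fun i => Jk (nth 0 k i)) A bb 1
  (fun i => @Jk_monotone_on R _) bb0 _ ler01.
rewrite mul1r.
have -> : \prod_(i < d.+1) bb i =
    \prod_(i < d.+1) c i * \prod_(i < d.+1) wfactor (tnth k i) t (tnth x i).
  by rewrite -big_split/=; apply: eq_bigr => i _; rewrite /bb !(tnth_nth 0).
move=> H; apply: (le_trans (H _)).
  by move=> i r r0; have [_] := hc i; apply => //; exact: relrad_gt0_le1.
set g := (X in (_ <= iterint _ X)%E).
suff : (0 <= iterint (fun i => Jk (nth 0%R k i)) (@box_cst R A 1 d.+1) <=
   iterint (fun i => Jk (nth 0%R k i)) g)%E by case/andP.
apply: (@iterint_mono R (@I11 R)) => [i|y Sy]; first exact: Jk_monotone_on.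
rewrite /box_cst; case: (in_boxP _ y) => [Ay|_]; last first.
  by rewrite lexx/= /g /chiB; case: ifP.
have Sy' i : -1 <= tnth y i <= 1 by have := Sy i; rewrite /I11/= in_itv.
rewrite lee_fin ler01/= /g /chiB ifT//; apply/andP; split.
  rewrite /vnorm -[leRHS]sqrtr1 ler_sqrt// -[leRHS]u1.
  apply: ler_sum => i _; rewrite tnth_mktuple -!expr2 exprMn.
  by rewrite ler_piMr ?sqr_ge0//; have := Sy' i; nra.
have hsum : \sum_(i < d.+1) tnth x i * tnth u i * (1 - tnth y i) <= b * t ^+ 2.
  apply: (@le_trans _ _ (\sum_(i < d.+1) be * t ^+ 2)); last first.
    rewrite sumr_const card_ord -[leLHS]mulr_natr -/n /be.
    by rewrite (_ : b / n * t ^+ 2 * n = b * t ^+ 2) //; field; lra.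
  apply: ler_sum => i _.
  have Ai : 1 - tnth y i <= be * relrad t (tnth x i).
    by have := Ay i; rewrite /A -tnth_nth.
  have y0 : 0 <= 1 - tnth y i by have := Sy' i; lra.
  (* Here [b <= 1 / 2] turns [1 - x.u <= b t^2] into a squared distance at most [t^2]. *)
  have ux : `|tnth u i - tnth x i| <= t.
    by apply: coord_dist_sphere => //; [exact: ltW|nra].
  have ut : `|tnth u i| <= `|tnth x i| + t.
    rewrite (_ : tnth u i = tnth x i + (tnth u i - tnth x i)); last by ring.
    by apply: (le_trans (ler_normD _ _)); rewrite lerD2l.
  have X0 := normr_ge0 (tnth x i); have U0 := normr_ge0 (tnth u i).
  set X := `|tnth x i| in ut X0 *.
  have XU : tnth x i * tnth u i <= (X + t) ^+ 2.
    apply: (le_trans (ler_norm _)); rewrite normrM -/X.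
    by rewrite expr2; apply: ler_pM => //; lra.
  have Xt : 0 < X + t by lra.
  apply: (@le_trans _ _ ((X + t) ^+ 2 * (1 - tnth y i))); first exact: ler_wpM2r.
  apply: (@le_trans _ _ ((X + t) ^+ 2 * (be * relrad t (tnth x i)))).
    by apply: ler_wpM2l => //; exact: sqr_ge0.
  rewrite /relrad -/X (_ : (X + t) ^+ 2 * (be * (t ^+ 2 / (X + t) ^+ 2)) = be * t ^+ 2)//.
  by field; rewrite gt_eqF.
have -> : dotp x [tuple tnth u i * tnth y i | i < d.+1] = dotp x u -
    \sum_(i < d.+1) tnth x i * tnth u i * (1 - tnth y i).
  rewrite /dotp -sumrB; apply: eq_bigr => i _; rewrite tnth_mktuple; ring.
lra.
Qed.

(** The size of [h_k] on the cap of radius [t]: an upper bound on the whole cap and, up to a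
    constant, a lower bound on the pushed boxes. *)
Definition hrad d (k x : d.+1.-tuple R) (t : R) : R :=
  \prod_(i < d.+1) (`|tnth x i| + t) `^ tnth k i.

Lemma hrad_gt0 d (k x : d.+1.-tuple R) t : 0 < t -> 0 < hrad k x t.
Proof.
move=> t0; apply: prodr_gt0 => i _; apply: powR_gt0.
by have := normr_ge0 (tnth x i); lra.
Qed.

Lemma hk_ge0 d (k x : d.+1.-tuple R) : 0 <= hk k x.
Proof. by apply: prodr_ge0 => i _; exact: powR_ge0. Qed.

Lemma hk_le_hrad d (k x u : d.+1.-tuple R) t : (forall i, 0 <= tnth k i) ->
  sphere R d x -> sphere R d u -> 0 < t <= pi -> cos t <= dotp x u ->
  hk k u <= hrad k x t.
Proof.
move=> k0 x1 u1 tpi cu; have /andP[t0 _] := tpi.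
apply: ler_prod => i _; rewrite powR_ge0/=.
apply: ge0_ler_powR; rewrite ?nnegrE//.
  by have := normr_ge0 (tnth x i); lra.
have ct := one_subr_cos_le tpi.
have ux : `|tnth u i - tnth x i| <= t.
  by apply: coord_dist_sphere => //; [exact: ltW|lra].
rewrite (_ : tnth u i = tnth x i + (tnth u i - tnth x i)); last by ring.
by apply: (le_trans (ler_normD _ _)); rewrite lerD2l.
Qed.

Lemma hk_ge_hrad d (k x u : d.+1.-tuple R) t e : (forall i, 0 <= tnth k i) ->
  0 < t -> 0 < e -> (forall i, e * (`|tnth x i| + t) <= `|tnth u i|) ->
  (\prod_(i < d.+1) e `^ tnth k i) * hrad k x t <= hk k u.
Proof.
move=> k0 t0 e0 h; rewrite -big_split/=; apply: ler_prod => i _.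
have x0 : 0 <= `|tnth x i| + t by have := normr_ge0 (tnth x i); lra.
rewrite mulr_ge0 ?powR_ge0//= -powRM ?(ltW e0)//.
by apply: ge0_ler_powR; rewrite ?nnegrE// mulr_ge0// ltW.
Qed.

Lemma norm_reflect_by d (e : d.+1.-tuple bool) (x : d.+1.-tuple R) i :
  `|tnth (reflect_by e x) i| = `|tnth x i|.
Proof. by rewrite tnth_mktuple; case: ifP; rewrite ?normrN. Qed.

Lemma reflect_by_sphere d (e : d.+1.-tuple bool) (x : d.+1.-tuple R) :
  sphere R d x -> sphere R d (reflect_by e x).
Proof.
rewrite /sphere /= => <-; apply: eq_bigr => i _.
by rewrite tnth_mktuple; case: ifP; rewrite ?mulrNN.
Qed.

(** Thus a single mass bound serves all the reflected caps. *)
Lemma hrad_reflect_by d (k : d.+1.-tuple R) (e : d.+1.-tuple bool) x t :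
  hrad k (reflect_by e x) t = hrad k x t.
Proof. by apply: eq_bigr => i _; rewrite norm_reflect_by. Qed.

End Intertwining.

(** * Measurability and linearity of the sphere integral *)

Section SphereIntegral.
Variable R : realType.
Local Open Scope classical_set_scope.

Lemma measurable_dotp d (f g : d.+1.-tuple R -> d.+1.-tuple R) :
  measurable_fun setT f -> measurable_fun setT g ->
  measurable_fun setT (fun y => dotp (f y) (g y)).
Proof.
move=> mf mg; rewrite /dotp.
apply: (measurable_sum _ (h := fun i y => tnth (f y) i * tnth (g y) i)) => i.
by apply: measurable_funM;
  [apply: (measurableT_comp (measurable_tnth _) mf)
  |apply: (measurableT_comp (measurable_tnth _) mg)].
Qed.

Lemma measurable_vnorm d : measurable_fun setT (@vnorm R d.+1).
Proof.
apply: (measurableT_comp (continuous_measurable_fun (@sqrt_continuous R))).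
by apply: measurable_dotp; exact: measurable_id.
Qed.

Lemma measurable_normalize d :
  measurable_fun setT (fun y : d.+1.-tuple R => vscale (vnorm y)^-1 y).
Proof.
apply/measurable_fun_tnthP => i.
(* The inverse is written as a real power, a measurable function that agrees with it on nonnegative
   numbers. *)
rewrite (_ : _ \o _ = fun y : d.+1.-tuple R => (vnorm y) `^ (-1) * tnth y i).
  apply: measurable_funM; last exact: measurable_tnth.
  exact: (measurableT_comp (measurable_powR (-1)) (@measurable_vnorm d)).
by apply/funext => y /=; rewrite tnth_mktuple powR_inv1// sqrtr_ge0.
Qed.

Lemma measurable_sphere d : measurable (sphere R d).
Proof.
have m : measurable_fun setT (fun x : d.+1.-tuple R => dotp x x).
  by apply: measurable_dotp; exact: measurable_id.
have := m measurableT [set 1] (measurable_set1 _).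
by rewrite setTI.
Qed.

(** Normalized points lie on the sphere, so [F] may be replaced by its extension by 0, which is
    measurable everywhere. *)
Lemma measurable_cone d (F : d.+1.-tuple R -> \bar R) :
  measurable_fun (sphere R d) F ->
  measurable_fun setT (fun y : d.+1.-tuple R =>
    if (0 < vnorm y) && (vnorm y <= 1) then F (vscale (vnorm y)^-1 y) else 0%E).
Proof.
move=> mF.
have mS : measurable (sphere R d) by exact: measurable_sphere.
have mFr : measurable_fun setT (F \_ (sphere R d)).
  by apply/(measurable_restrictT _ _).1.
rewrite (_ : (fun y => _) = fun y : d.+1.-tuple R =>
    if (0 < vnorm y) && (vnorm y <= 1)
    then (F \_ (sphere R d)) (vscale (vnorm y)^-1 y) else 0%E); last first.
  apply/funext => y; case: ifPn => // /andP[y0 _].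
  by rewrite patchE mem_set//; exact: sphere_normalize.
apply: measurable_fun_ifT => //.
- apply: measurable_and.
    exact: (measurable_fun_ltr (measurable_cst _) (@measurable_vnorm d)).
  exact: (measurable_fun_ler (@measurable_vnorm d) (measurable_cst _)).
- exact: (measurableT_comp mFr (@measurable_normalize d)).
Qed.

Lemma sphere_int_ge0 d (F : d.+1.-tuple R -> \bar R) :
  (forall u, sphere R d u -> (0 <= F u)%E) -> (0 <= sphere_int F)%E.
Proof.
move=> F0; apply: mule_ge0 => //; apply: leb_int_ge0 => y.
by case: ifPn => // /andP[y0 _]; exact/F0/sphere_normalize.
Qed.

Lemma le_sphere_int d (F G : d.+1.-tuple R -> \bar R) :
  (forall u, sphere R d u -> (0 <= F u <= G u)%E) ->
  (sphere_int F <= sphere_int G)%E.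
Proof.
move=> FG; apply: lee_wpmul2l => //.
set g := (X in (leb_int X <= _)%E); set h := (X in (_ <= leb_int X)%E).
suff : (0 <= leb_int g <= leb_int h)%E by case/andP.
apply: leb_int_mono => y; rewrite /g /h.
case: ifPn => [/andP[y0 _]|_]; last by rewrite lexx.
exact/FG/sphere_normalize.
Qed.

(** Additivity, unlike monotonicity, needs measurable integrands; the measurability of [f] enters
    the theorem here. *)
Lemma sphere_int_sumZ d (I : finType) (r : R) (F : I -> d.+1.-tuple R -> \bar R) :
  0 <= r -> (forall i, measurable_fun (sphere R d) (F i)) ->
  (forall i u, (0 <= F i u)%E) ->
  sphere_int (fun u => (r%:E * \sum_(i : I) F i u)%E) =
  (r%:E * \sum_(i : I) sphere_int (F i))%E.
Proof.
move=> r0 mF F0; rewrite /sphere_int.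
pose G i (y : d.+1.-tuple R) := if (0 < vnorm y) && (vnorm y <= 1)
   then F i (vscale (vnorm y)^-1 y) else 0%E.
have G0 i y : (0 <= G i y)%E by rewrite /G; case: ifP.
have mG i : measurable_fun setT (G i) by exact: measurable_cone.
rewrite -ge0_sume_distrr; last first.
  by move=> i _; apply: leb_int_ge0 => y; exact: G0.
rewrite muleCA; congr (_ * _)%E.
rewrite -leb_int_sum// -leb_intZ//.
- congr leb_int; apply/funext => y; rewrite /G; case: ifP => // _.
  by rewrite big1 ?mule0.
- exact: emeasurable_sum.
- by move=> y; apply: sume_ge0 => i _; exact: G0.
Qed.

End SphereIntegral.

(** * Bounds for the numerators and denominators of the maximal quotients *)

Section Maximal.
Variable R : realType.
Local Open Scope classical_set_scope.

Lemma measurable_hk d (k : d.+1.-tuple R) : measurable_fun setT (hk k).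
Proof.
rewrite /hk; apply: (measurable_prod
  (h := fun i (x : d.+1.-tuple R) => `|tnth x i| `^ tnth k i)) => i _.
apply: (measurableT_comp (measurable_powR _)).
by apply: measurableT_comp => //; exact: measurable_tnth.
Qed.

Lemma measurable_cap_integrand d (k : d.+1.-tuple R) (f : d.+1.-tuple R -> R)
    (x : d.+1.-tuple R) (t : R) :
  measurable_fun (sphere R d) f ->
  measurable_fun (sphere R d) (fun y => if (cos t <= dotp x y)%R
     then (`|f y| * hk k y ^+ 2)%R%:E else 0%E).
Proof.
move=> mf.
apply: measurable_fun_if => //.
- exact: measurable_sphere.
- apply: measurable_funTS; apply: measurable_fun_ler => //.
  by apply: measurable_dotp; [exact: measurable_cst|exact: measurable_id].
- apply: (measurable_funS (@measurable_sphere R d)) => //.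
  apply/measurable_EFinP; apply: measurable_funM.
    exact: measurableT_comp.
  by apply: measurable_funTS; apply: measurable_funX; exact: measurable_hk.
Qed.

(** The upper bound controls the denominator of [M_ratio]; the strict positivity makes its inverse
    meaningful. *)
Lemma cap_mass_bounds d (k : d.+1.-tuple R) : (forall i, 0 <= tnth k i) ->
  exists2 C : R, 0 < C & forall (x : d.+1.-tuple R) (t : R),
  sphere R d x -> 0 < t <= pi ->
  (0 < sphere_int (fun y : d.+1.-tuple R =>
    if (cos t <= dotp x y)%R then (hk k y ^+ 2)%R%:E else 0) <= (C * (hrad k x t ^+ 2 * t ^+ d))%:E)%E.
Proof.
move=> k0; exists (d.+1%:R * ((1 + pi) * 4 ^+ d.+1)).
  have := pi_gt0 R => p0; apply: mulr_gt0 => //.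
  by apply: mulr_gt0; [lra|exact: exprn_gt0].
move=> x t x1 tpi; have /andP[t0 _] := tpi.
have F0 (u : d.+1.-tuple R) : (0 <= (if (cos t <= dotp x u)%R
    then (hk k u ^+ 2)%R%:E else 0%E))%E.
  by case: ifP => // _; rewrite lee_fin sqr_ge0.
apply/andP; split; last first.
  apply: (@sphere_int_cap_le R d x t) => //; first exact: sqr_ge0.
  - move=> u u1 cu; rewrite cu lee_fin; apply: lerXn2r.
    + by rewrite nnegrE hk_ge0.
    + by rewrite nnegrE ltW// hrad_gt0.
    + exact: hk_le_hrad.
  - by move=> u u1; rewrite ltNge => /negbTE ->.
pose b : R := (cos 1 / 4) ^+ 2.
have c1 := cos1_gt0 R; have c1' := cos_le1 (1 : R).
have b01 : 0 < b <= 1 by rewrite /b; apply/andP; split; nra.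
have [e [c [e0 c0 H]]] := @sphere_int_cap_ge R d b b01.
pose v := ((\prod_(i < d.+1) e `^ tnth k i) * hrad k x t) ^+ 2.
have v0 : 0 < v.
  apply: exprn_gt0; apply: mulr_gt0; last exact: hrad_gt0.
  by apply: prodr_gt0 => i _; exact: powR_gt0.
apply: (@lt_le_trans _ _ (c * (v * t ^+ d))%:E).
  rewrite lte_fin; apply: mulr_gt0 => //; apply: mulr_gt0 => //.
  exact: exprn_gt0.
apply: (H x t v _ x1 tpi (ltW v0)) => // u u1 du hu.
have -> : cos t <= dotp x u.
  have := one_subr_cos_ge tpi; rewrite -/b.
  have : 0 <= b * t ^+ 2 by rewrite mulr_ge0 ?sqr_ge0//; lra.
  lra.
rewrite lee_fin; apply: lerXn2r.
- rewrite nnegrE mulr_ge0 ?(ltW (hrad_gt0 _ _ t0))//.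
  by apply: prodr_ge0 => i _; exact: powR_ge0.
- by rewrite nnegrE hk_ge0.
- exact: hk_ge_hrad.
Qed.

(** On the packed boxes both factors are large at once: [V_k] is at least [c' P] and [h_k] at least
    [E * hrad k x t]. *)
Lemma intertwined_mass_ge d (k : d.+1.-tuple R) : (forall i, 0 <= tnth k i) ->
  exists2 c : R, 0 < c & forall (x : d.+1.-tuple R) (t : R),
  sphere R d x -> 0 < t <= pi ->
  ((c * (\prod_(i < d.+1) wfactor (tnth k i) t (tnth x i) *
      (hrad k x t ^+ 2 * t ^+ d)))%:E <=
   sphere_int (fun y => (Vk k (chiB x t) y * (hk k y ^+ 2)%R%:E)))%E.
Proof.
move=> k0.
pose b : R := (cos 1 / 4) ^+ 2.
have c1 := cos1_gt0 R; have c1' := cos_le1 (1 : R).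
have b01 : 0 < b <= 1 by rewrite /b; apply/andP; split; nra.
have b012 : 0 < b <= 1 / 2 by rewrite /b; apply/andP; split; nra.
have [e [c [e0 c0 H]]] := @sphere_int_cap_ge R d b b01.
have [c' c'0 H'] := Vk_chiB_ge k0 b012.
pose E : R := \prod_(i < d.+1) e `^ tnth k i.
have E0 : 0 < E by apply: prodr_gt0 => i _; exact: powR_gt0.
exists (c * (c' * E ^+ 2)).
  by apply: mulr_gt0 => //; apply: mulr_gt0 => //; exact: exprn_gt0.
move=> x t x1 tpi; have /andP[t0 _] := tpi.
set P := \prod_(i < d.+1) _.
have P0 : 0 <= P by apply: prodr_ge0 => i _; exact: wfactor_ge0.
rewrite (_ : _ * _ = c * ((c' * P * (E * hrad k x t) ^+ 2) * t ^+ d)); last first.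
  by move: (t ^+ d) => ?; ring.
have h0 := hrad_gt0 k x t0.
apply: (H x t) => //.
- by rewrite mulr_ge0 ?sqr_ge0// mulr_ge0// ltW.
- by move=> u u1; apply: mule_ge0; [exact: Vk_ge0|rewrite lee_fin sqr_ge0].
move=> u u1 du hu; rewrite EFinM; apply: lee_pmul.
- by rewrite lee_fin mulr_ge0// ltW.
- by rewrite lee_fin sqr_ge0.
- by apply: H' => //; exact: one_subr_cos_ge.
- rewrite lee_fin; apply: lerXn2r.
  + by rewrite nnegrE mulr_ge0// ltW.
  + by rewrite nnegrE hk_ge0.
  + exact: hk_ge_hrad.
Qed.

(** Each [u] needs only one reflection, which varies with [u]; summing over all of them gives a
    bound free of that choice. *)
Lemma intertwined_integral_le d (k : d.+1.-tuple R) : (forall i, 0 <= tnth k i) ->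
  exists2 C : R, 0 < C & forall (f : d.+1.-tuple R -> R) (x : d.+1.-tuple R) (t : R),
  measurable_fun (sphere R d) f -> sphere R d x -> 0 < t <= pi ->
  (sphere_int (fun y => ((`|f y| * hk k y ^+ 2)%R%:E * Vk k (chiB x t) y)) <=
   (C * \prod_(i < d.+1) wfactor (tnth k i) t (tnth x i))%:E *
   \sum_(e : d.+1.-tuple bool) sphere_int (fun y =>
      if (cos t <= dotp (reflect_by e x) y)%R
      then (`|f y| * hk k y ^+ 2)%R%:E else 0))%E.
Proof.
move=> k0; have [C C0 H] := Vk_chiB_le k0; exists C => // f x t mf x1 tpi.
set P := \prod_(i < d.+1) _.
have P0 : 0 <= P by apply: prodr_ge0 => i _; exact: wfactor_ge0.
pose F (e : d.+1.-tuple bool) (y : d.+1.-tuple R) : \bar R :=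
  if (cos t <= dotp (reflect_by e x) y)%R
  then (`|f y| * hk k y ^+ 2)%R%:E else 0%E.
have fh0 y : 0 <= `|f y| * hk k y ^+ 2 by rewrite mulr_ge0 ?sqr_ge0.
have F0 e y : (0 <= F e y)%E by rewrite /F; case: ifP => // _; rewrite lee_fin.
rewrite -(@sphere_int_sumZ R d _ (C * P) F)//; last 2 first.
- by rewrite mulr_ge0// ltW.
- by move=> e; exact: measurable_cap_integrand.
apply: le_sphere_int => u u1; apply/andP; split.
  by apply: mule_ge0; [rewrite lee_fin|exact: Vk_ge0].
(* This reflection flips exactly the coordinates in which [x] and [u] have opposite signs. *)
pose e : d.+1.-tuple bool := [tuple (tnth x i * tnth u i < 0) | i < d.+1].
have sg i : 0 <= tnth (reflect_by e x) i * tnth u i.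
  by rewrite !tnth_mktuple; case: ltP => // h; rewrite mulNr oppr_ge0 ltW.
have := H e x u t x1 (reflect_by_sphere e x1) u1 tpi sg; rewrite -/P => V.
apply: (@le_trans _ _ ((C * P)%:E * F e u)%E); last first.
  apply: lee_wpmul2l; first by rewrite lee_fin mulr_ge0// ltW.
  by rewrite (bigD1 e)//= leeDl// sume_ge0.
rewrite muleC /F; apply: (@le_trans _ _ _ _ _ (lee_wpmul2r _ V)).
  by rewrite lee_fin.
by case: ifP => _; rewrite ?mul0e ?mule0.
Qed.

End Maximal.

(** * Comparison of the two quotients at a fixed angle *)

Unset Implicit Arguments.

Theorem theorem3p5 (R : realType) (d : nat) (k : d.+1.-tuple R) :
  (forall i : 'I_d.+1, 0 <= tnth k i) ->
  exists c : R, 0 < c /\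
    forall f : d.+1.-tuple R -> R, L1_hk k f ->
    forall x : d.+1.-tuple R, sphere R d x ->
      (Mcal k f x <= c%:E * \sum_(e : d.+1.-tuple bool) Msmall k f (reflect_by e x))%E.
Proof.
move=> k0.
have [C1 C10 H1] := intertwined_integral_le k0.
have [c2 c20 H2] := intertwined_mass_ge k0.
have [C3 C30 H3] := cap_mass_bounds k0.
(* The numerator is at most [C1 P (C3 A) S] and the denominator at least [c2 P A]; [P] and [A]
   cancel. *)
exists (C1 * C3 / c2); split; first by rewrite divr_gt0// mulr_gt0.
move=> f [mf _] x x1; apply: ge_ereal_sup => _ [t /= + <-].
rewrite in_itv/= => tpi; have /andP[t0 _] := tpi.
have fh0 y : 0 <= `|f y| * hk k y ^+ 2 by rewrite mulr_ge0 ?sqr_ge0.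
pose P := \prod_(i < d.+1) wfactor (tnth k i) t (tnth x i).
have P0 : 0 <= P by apply: prodr_ge0 => i _; exact: wfactor_ge0.
pose A := hrad k x t ^+ 2 * t ^+ d.
have A0 : 0 < A by rewrite mulr_gt0 ?exprn_gt0// hrad_gt0.
pose num (e : d.+1.-tuple bool) := sphere_int (fun y : d.+1.-tuple R =>
  if (cos t <= dotp (reflect_by e x) y)%R
  then (`|f y| * hk k y ^+ 2)%R%:E else 0%E).
have num0 e : (0 <= num e)%E.
  by apply: sphere_int_ge0 => u _; case: ifP => // _; rewrite lee_fin.
pose S := (\sum_(e : d.+1.-tuple bool) Msmall k f (reflect_by e x))%E.
have num_le e : (num e <= (C3 * A)%:E * Msmall k f (reflect_by e x))%E.
  have CA : 0 < C3 * A by rewrite mulr_gt0.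
  rewrite muleC -lee_pdivrMr//.
  apply: (@le_trans _ _ (M_ratio k f (reflect_by e x) t)); last first.
    by apply: ereal_sup_ubound; exists t => //=; rewrite in_itv.
  rewrite /M_ratio; apply: lee_wpmul2l; first exact: num0.
  have /andP[] := H3 _ t (reflect_by_sphere e x1) tpi.
  rewrite hrad_reflect_by -/A; set m := sphere_int _ => m0 m1.
  have mfin : m \is a fin_num.
    by rewrite ge0_fin_numE ?(ltW m0)//; apply: le_lt_trans m1 (ltry _).
  rewrite lee_fin lef_pV2 ?posrE//; last by rewrite fine_gt0// m0/= ltey_eq mfin.
  by rewrite -lee_fin fineK.
(* Nonnegativity of the supremum is read off from [num_le], as [C3 * A] is positive. *)
have M0 e : (0 <= Msmall k f (reflect_by e x))%E.
  have CA : (0 < (C3 * A)%:E)%E by rewrite lte_fin mulr_gt0.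
  rewrite -(pmule_rge0 _ CA).
  exact: le_trans (num0 e) (num_le e).
have S0 : (0 <= S)%E by apply: sume_ge0 => e _; exact: M0.
have := H1 f x t mf x1 tpi; rewrite -/P => top.
have {}top : (sphere_int (fun y => ((`|f y| * hk k y ^+ 2)%R%:E * Vk k (chiB x t) y)%E)
    <= (C1 * P * (C3 * A))%:E * S)%E.
  apply: (le_trans top); rewrite [X in (_ <= X * _)%E]EFinM -muleA.
  apply: lee_wpmul2l; first by rewrite lee_fin mulr_ge0// ltW.
  by rewrite ge0_sume_distrr//; apply: lee_sum => e _; exact: num_le.
rewrite /Mcal_ratio; have := H2 x t x1 tpi; rewrite -/P -/A.
set D := sphere_int _ => hD.
have cS0 : (0 <= (C1 * C3 / c2)%:E * S)%E.
  by apply: mule_ge0 => //; rewrite lee_fin ltW// divr_gt0// mulr_gt0.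
(* If [D = +oo] then [fine D = 0] and the quotient is [0]. *)
have [Dfin|Dinf] := boolP (D \is a fin_num); last first.
  rewrite (_ : fine D = 0) ?invr0 ?mule0//.
  by move: Dinf; case: (D).
have {}hD : c2 * (P * A) <= fine D by rewrite -lee_fin fineK.
(* [P] vanishes only if some factor [ck] does; [top] then bounds the numerator by 0. *)
have [PE|PE] := eqVneq P 0.
  apply: (le_trans _ cS0); rewrite -[leRHS](mul0e (fine D)^-1%:E).
  apply: lee_wpmul2r.
    rewrite lee_fin invr_ge0; apply: le_trans hD.
    by rewrite PE mul0r mulr0.
  by apply: (le_trans top); rewrite PE mulr0 mul0r mul0e.
have {PE}P0' : 0 < P by rewrite lt_neqAle eq_sym PE.
have cPA : 0 < c2 * (P * A) by apply: mulr_gt0 => //; exact: mulr_gt0.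
apply: (@le_trans _ _ ((C1 * P * (C3 * A))%:E * S * (c2 * (P * A))^-1%:E)%E).
  apply: lee_pmul => //.
  - apply: sphere_int_ge0 => u _; apply: mule_ge0; last exact: Vk_ge0.
    by rewrite lee_fin.
  - by rewrite lee_fin invr_ge0 (le_trans (ltW cPA)).
  - by rewrite lee_fin lef_pV2 ?posrE// (lt_le_trans cPA).
rewrite muleAC -EFinM; apply: lee_wpmul2r => //.
rewrite lee_fin le_eqVlt; apply/orP; left; apply/eqP; field.
by rewrite !gt_eqF.
Qed.
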